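(* Let $d\ge1$ and let $W:\mathbb{R}^d\to\mathbb{R}\cup\{+\infty\}$ be lower semicontinuous, bounded from below by a finite constant $W_{\min}\in\mathbb{R}$, locally integrable and symmetric ($W(-x)=W(x)$ for all $x$). Suppose that $W_\infty:=\lim_{|x|\to\infty}W(x)$ exists in $\mathbb{R}\cup\{+\infty\}$ and that there is $R_W>0$ such that $W$ is radially strictly increasing on $\mathbb{R}^d\setminus B_{R_W}$. (A) If $W$ is bounded from above and upper semicontinuous, then for every $N\ge2$ and every minimiser $\boldsymbol{X}\in\mathbb{R}^{Nd}$ of $E_N$, $$|P_i(\boldsymbol{X})-2E_N(\boldsymbol{X})|\le\frac{W(0)-W_{\min}}{N}\quad\text{for all }i\in\{1,\dots,N\}.$$ (B) If $W$ is $\beta$-repulsive for some $2<\beta<d$, $W\in C^1(\mathbb{R}^d\setminus\{0\})$, and there is $C_W>0$ such that $\Delta^0W(x)\le C_W$ for all $x\in\mathbb{R}^d$, $W(x)\le C_W|x|^{2-\beta}$ for all $|x|\le1$, and $|\nabla W(x)|\le C_W|x|^{1-\beta}$ for all $0<|x|\le1$, then there exist $A>1$ and $k\in(0,1]$ (independent of $N$ and $\boldsymbol{X}$) such that for every $N\ge2$ and every minimiser $\boldsymbol{X}\in\mathbb{R}^{Nd}$ of $E_N$, $$|P_i(\boldsymbol{X})-2E_N(\boldsymbol{X})|\le AN^{-k}\quad\text{for all }i\in\{1,\dots,N\};$$ one can take $k=\frac{2}{(\beta-1)\beta}$.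
   Context: $B_R$ is the open ball of radius $R$ centred at $0$ in $\mathbb{R}^d$. ''Radially strictly increasing on $\mathbb{R}^d\setminus B_{R_W}$'' means $W(x)<W(y)$ whenever $R_W\le|x|<|y|$. For $N\ge2$ and $\boldsymbol{X}=(x_1,\dots,x_N)\in\mathbb{R}^{Nd}$, $E_N(\boldsymbol{X})=\frac{1}{2N^2}\sum_{i=1}^N\sum_{j\ne i}W(x_i-x_j)$ and $P_i(\boldsymbol{X})=\frac1N\sum_{j\ne i}W(x_i-x_j)$. A minimiser is a global minimiser on $\mathbb{R}^{Nd}$. Generalised Laplacian: $\Delta^\varepsilon W(x)=\frac{2(d+2)}{\varepsilon^2}\left(\frac{1}{|B_\varepsilon|}\int_{B_\varepsilon}W(x+y)\,dy-W(x)\right)$ for $\varepsilon>0$ (equal to $-\infty$ if $W(x)=+\infty$), and $\Delta^0W(x)=\liminf_{\varepsilon\to0}\Delta^\varepsilon W(x)\in[-\infty,+\infty]$. $W$ is $\beta$-repulsive if it is locally integrable and there exist $\delta>0$, $C>0$ with $-\Delta^0W(x)\ge C|x|^{-\beta}$ for all $0<|x|<\delta$ and $-\Delta^0W(0)=+\infty$. In (B), $|0|^{2-\beta}=+\infty$. *)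

(* Defs.v *)
From HB Require Import structures.
From mathcomp Require Import all_boot all_order all_algebra.
From mathcomp Require Import all_classical all_reals all_analysis.

Set Implicit Arguments.
Unset Strict Implicit.
Unset Printing Implicit Defensive.

Import Order.TTheory GRing.Theory Num.Theory.
Import numFieldNormedType.Exports.

Local Open Scope classical_set_scope.
Local Open Scope ring_scope.

Fact rV_display : measure_display. Proof. exact: default_measure_display. Qed.

Section measurable_rV.
Context {R : realType} (n : nat).

(* The sigma-algebra of R^n is generated by the coordinates, as for n.-tuple;
   over R this is the Borel sigma-algebra. *)
Definition rV_coord (i : 'I_n) (x : 'rV[R]_n) : measurableTypeR R := x ord0 i.

Let rV_set0 : g_sigma_preimage rV_coord set0.
Proof. exact: sigma_algebra0. Qed.

Let rV_setC A : g_sigma_preimage rV_coord A -> g_sigma_preimage rV_coord (~` A).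
Proof. exact: sigma_algebraC. Qed.

Let rV_bigcup (F : (set 'rV[R]_n)^nat) :
  (forall i, g_sigma_preimage rV_coord (F i)) ->
  g_sigma_preimage rV_coord (\bigcup_i (F i)).
Proof. exact: sigma_algebra_bigcup. Qed.

HB.instance Definition _ := @isMeasurable.Build rV_display
  'rV[R]_n (g_sigma_preimage rV_coord) rV_set0 rV_setC rV_bigcup.

End measurable_rV.

Section measurable_rV_theory.
Context {R : realType}.

Lemma measurable_rV_coord n (i : 'I_n) :
  measurable_fun [set: 'rV[R]_n] (@rV_coord R n i).
Proof.
move=> _ Y mY; rewrite setTI; apply: sub_sigma_algebra => /=.
rewrite -bigcup_seq/=; exists i => /=; first by rewrite mem_index_enum.
by exists Y => //; rewrite setTI.
Qed.

Lemma measurable_fun_rVP d (T : measurableType d) n (f : T -> 'rV[R]_n) :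
  measurable_fun [set: T] f <->
  forall i, measurable_fun [set: T] (@rV_coord R n i \o f).
Proof.
split=> [mf i|mf].
  by apply: measurableT_comp => //; exact: measurable_rV_coord.
have sub : g_sigma_preimage (fun i => @rV_coord R n i \o f) `<=` measurable.
  apply: smallest_sub; first exact: sigma_algebra_measurable.
  case: n => [|n] in f mf *; first by rewrite big_ord0.
  rewrite -bigcup_mkord_ord; apply: bigcup_sub => i Ii.
  by move=> A [B mB <-]; exact: mf.
by move=> _ A mA; apply: sub; rewrite g_sigma_preimage_comp; exists A.
Qed.

Definition cons_rV n (p : measurableTypeR R * 'rV[R]_n) : 'rV[R]_n.+1 :=
  row_mx (const_mx p.1 : 'rV_1) p.2.

Lemma cons_rV0 n p : @cons_rV n p ord0 ord0 = p.1.
Proof.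
rewrite /cons_rV; have -> : ord0 = lshift n (ord0 : 'I_1) by apply/val_inj.
by apply: (etrans (row_mxEl _ _ _ _)); rewrite mxE.
Qed.

Lemma cons_rVS n p j : @cons_rV n p ord0 (lift ord0 j) = p.2 ord0 j.
Proof.
rewrite /cons_rV; have -> : lift ord0 j = rshift 1 j by apply/val_inj.
exact: row_mxEr.
Qed.

Lemma measurable_cons_rV n : measurable_fun setT (@cons_rV n).
Proof.
apply/measurable_fun_rVP => i; case: (unliftP ord0 i) => [j ->|->].
  rewrite (_ : _ \o _ = @rV_coord R n j \o snd).
    by apply: measurableT_comp; [exact: measurable_rV_coord|exact: measurable_snd].
  by apply/funext => p; exact: cons_rVS.
rewrite (_ : _ \o _ = fst); first exact: measurable_fst.
by apply/funext => p; exact: cons_rV0.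
Qed.

Definition uncons_rV n (x : 'rV[R]_n.+1) : measurableTypeR R * 'rV[R]_n :=
  (x ord0 ord0, rsubmx (x : 'rV_(1 + n))).

Lemma measurable_uncons_rV n : measurable_fun setT (@uncons_rV n).
Proof.
apply/measurable_fun_pairP; split; first exact: (measurable_rV_coord ord0).
apply/measurable_fun_rVP => j.
rewrite (_ : _ \o _ = @rV_coord R n.+1 (rshift 1 j)).
  exact: measurable_rV_coord.
by apply/funext => x; rewrite /= /rV_coord mxE.
Qed.

Lemma cons_rVK n : cancel (@cons_rV n) (@uncons_rV n).
Proof. by move=> [t x]; rewrite /uncons_rV cons_rV0 row_mxKr. Qed.

End measurable_rV_theory.

Section cons_measure.
Local Open Scope ereal_scope.
Context {R : realType} (n : nat).
Variable mu : {sigma_finite_measure set 'rV[R]_n -> \bar R}.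

Definition cons_measure : set 'rV[R]_n.+1 -> \bar R :=
  pushforward (@lebesgue_measure R \x mu) (@cons_rV R n).

Let mcons := @measurable_cons_rV R n.

Let cons_measure0 : cons_measure set0 = 0.
Proof. by have := mcons => mf; exact: measure0. Qed.

Let cons_measure_ge0 A : 0 <= cons_measure A.
Proof. by have := mcons => mf; exact: measure_ge0. Qed.

Let cons_measure_sigma_additive : semi_sigma_additive cons_measure.
Proof. by have := mcons => mf; exact: measure_semi_sigma_additive. Qed.

HB.instance Definition _ := isMeasure.Build _ _ _ cons_measure
  cons_measure0 cons_measure_ge0 cons_measure_sigma_additive.

Let cons_measure_sigma_finite : sigma_finite setT cons_measure.
Proof.
have /sigma_finiteP[F [TF ndF Foo]] := sigma_finiteT (@lebesgue_measure R).
have /sigma_finiteP[G [TG ndG Goo]] := sigma_finiteT mu.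
exists (fun k => @uncons_rV R n @^-1` (F k `*` G k)).
  rewrite -preimage_bigcup (_ : \bigcup_k _ = setT) ?preimage_setT//.
  rewrite -setXTT TF TG predeqE => -[x y]; split.
    by move=> [k _ []/= ? ?]; split; exists k.
  move=> [/= [k _ Fkx] [l _ Gly]]; exists (maxn k l) => //; split.
  - by move: x Fkx; exact/subsetPset/ndF/leq_maxl.
  - by move: y Gly; exact/subsetPset/ndG/leq_maxr.
move=> k; have [mF Fk] := Foo k; have [mG Gk] := Goo k; split.
  rewrite -[X in measurable X]setTI; apply: measurable_uncons_rV => //.
  exact: measurableX.
rewrite /cons_measure /pushforward -comp_preimage (_ : _ \o _ = id); last first.
  by apply/funext => p; exact: cons_rVK.
rewrite preimage_id product_measure1E// lte_mul_pinfty// ge0_fin_numE//.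
Qed.

HB.instance Definition _ := Measure_isSigmaFinite.Build _ _ _ cons_measure
  cons_measure_sigma_finite.

End cons_measure.

Fixpoint lebesgue_rV {R : realType} n :
    {sigma_finite_measure set 'rV[R]_n -> \bar R} :=
  if n is m.+1 then cons_measure (lebesgue_rV m) else dirac (0 : 'rV[R]_0).

Lemma lebesgue_rV_box {R : realType} n (A : 'I_n -> set (measurableTypeR R)) :
  (forall i, measurable (A i)) ->
  lebesgue_rV n [set x : 'rV[R]_n | forall i, A i (x ord0 i)] =
  (\prod_(i < n) lebesgue_measure (A i))%E.
Proof.
elim: n A => [|n IH] A mA.
  rewrite big_ord0/= diracE mem_set//= => -[].
  by [].
rewrite big_ord_recl/= -IH//.
have mB : measurable [set x : 'rV[R]_n | forall i, A (lift ord0 i) (x ord0 i)].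
  rewrite [X in measurable X](_ : _ =
      \big[setI/setT]_(i < n) (@rV_coord R n i @^-1` A (lift ord0 i))); last first.
    rewrite -bigcap_seq; apply/seteqP; split => [x xA i _|x xA i]; first exact: xA.
    by apply: (xA i); rewrite /= mem_index_enum.
  apply: bigsetI_measurable => i _; rewrite -[X in measurable X]setTI.
  exact: measurable_rV_coord.
rewrite -product_measure1E//; congr (product_measure1 _ _ _).
apply/seteqP; split => -[t x] /= xA.
  split=> [|j]; first by have := xA ord0; rewrite cons_rV0.
  by have := xA (lift ord0 j); rewrite cons_rVS.
move=> i; case: (unliftP ord0 i) => [j ->|->]; last by rewrite cons_rV0; case: xA.
by rewrite cons_rVS; case: xA.
Qed.

Section euclidean.
Context {R : realType} {d : nat}.
Implicit Types x y : 'rV[R]_d.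

(* The library's norm on 'rV[R]_d is the sup norm; its topology is the usual
   one. *)
Definition enorm x : R := Num.sqrt (\sum_(i < d) x ord0 i ^+ 2).

Definition eball (r : R) : set 'rV[R]_d := [set y | enorm y < r].

Definition at_infinity : set_system 'rV[R]_d :=
  filter_from setT (fun M : R => [set x | M < enorm x]).

(* |x|^s in [0, +oo] for s < 0, with |0|^s = +oo; powR has 0 `^ s = 0. *)
Definition enorm_npow x (s : R) : \bar R :=
  if x == 0 then +oo%E else (enorm x `^ s)%:E.

Definition gradient (w : 'rV[R]_d -> R) x : 'rV[R]_d :=
  \row_(i < d) 'D_(delta_mx ord0 i) w x.

End euclidean.

Section potentials.
Local Open Scope ereal_scope.
Context {R : realType} {d : nat}.
Implicit Types (W : 'rV[R]_d -> \bar R) (x y : 'rV[R]_d).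

Definition upper_semicontinuous W := forall x a, W x < a%:E ->
  exists2 V, nbhs x V & forall y, V y -> W y < a%:E.

Definition locally_integrable_rV W :=
  forall K : set 'rV[R]_d, compact K -> (lebesgue_rV d).-integrable K W.

Definition radially_increasing_outside (r : R) W :=
  forall x y, (r <= enorm x)%R -> (enorm x < enorm y)%R -> W x < W y.

(* W takes values in \bar R, so being C^1 away from 0 includes being finite
   there. *)
Definition C1_off_origin W :=
  (forall x, x != 0%R -> W x \is a fin_num) /\
  (forall x, x != 0%R -> differentiable (fine \o W) x /\
     {for x, continuous (gradient (fine \o W))}).

Definition laplacian_eps (eps : R) W x : \bar R :=
  if W x == +oo then -oo else
  (2 * (d%:R + 2) / eps ^+ 2)%:E *
  ((fine (lebesgue_rV d (eball eps)))^-1%:E *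
     (\int[lebesgue_rV d]_(y in eball eps) W (x + y)%R) - W x).

Definition laplacian0 W x : \bar R :=
  limf_einf (fun eps : R => laplacian_eps eps W x) 0^'+.

Definition repulsive (beta : R) W :=
  locally_integrable_rV W /\
  exists delta C : R, [/\ (0 < delta)%R, (0 < C)%R,
    forall x, (0 < enorm x < delta)%R ->
      (C * enorm x `^ (- beta))%:E <= - laplacian0 W x &
    - laplacian0 W 0%R = +oo].

Definition potential W N (X : 'I_N -> 'rV[R]_d) (i : 'I_N) : \bar R :=
  (N%:R^-1)%:E * \sum_(j < N | j != i) W (X i - X j)%R.

Definition energy W N (X : 'I_N -> 'rV[R]_d) : \bar R :=
  ((2 * N%:R ^+ 2)^-1)%:E *
  \sum_(i < N) \sum_(j < N | j != i) W (X i - X j)%R.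

Definition minimiser W N (X : 'I_N -> 'rV[R]_d) :=
  forall Y : 'I_N -> 'rV[R]_d, energy W X <= energy W Y.

End potentials.

(* Main.v *)
(** Let [N P_i] be the sum of the [W (x_i - x_j)] over [j <> i].  Moving the
    particle [i] to a point [y] cannot decrease the energy, so [N P_i] is at
    most the sum of the [W (y - x_j)] over [j <> i].

    (A) The choice [y = x_k] gives [P_i <= P_k + (W 0 - Wmin) / N] for all [i]
    and [k], and [2 E_N] is the mean of the [P_k].

    (B) Here [W 0 = +oo] and [y] is taken at distance about [N^(-1/beta)] from
    [x_k].  The potential [Phi] of the particles other than [k] is minimal at
    [x_k], and a mean value inequality yields such a [y] with
    [Phi y <= Phi x_k + O(N^(-2/beta))]; the self-interaction [W (y - x_k) / N]
    is [O(N^(-2/beta))] too, and [2 / ((beta - 1) beta) <= 2 / beta].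

    The generalised Laplacian is a lower limit, hence not additive, so the mean
    value inequality is proved for [W] itself, in a form that is linear in [W]:
    if [f <= W] is smooth, the average of [f] along a random walk of small step
    up to time [t] is at most [W + O(t)].  Indeed at a minimum of the difference
    of [W] and that average, [W] is touched from below by a smooth function,
    whose Laplacian is therefore bounded by that of [W].  Smooth minorants close
    to a truncation of [W] are spline quasi-interpolants. *)
Require Import Defs.
From HB Require Import structures.
From mathcomp Require Import all_boot all_order all_algebra.
From mathcomp Require Import perm ring lra.
From mathcomp Require Import all_classical all_reals all_analysis measurable_realfun.

Set Implicit Arguments.
Unset Strict Implicit.
Unset Printing Implicit Defensive.

Import Order.TTheory GRing.Theory Num.Theory.
Import numFieldNormedType.Exports.

Local Open Scope classical_set_scope.
Local Open Scope ring_scope.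

(** * Symmetries of the Lebesgue measure *)

Section lebesgue_rV_invariance.
Context {R : realType}.

(** The Laplacian of a sum of translates of [W] is never formed: the comparison is proved for one
    minorant of [W], and its conclusion, linear in that minorant, is summed over the particles. A
    random walk in the role of the heat flow keeps this algebraic. A step is an average of
    translates, so Taylor constants do not grow, supports grow by one step length, and second and
    fourth moments obey short recursions. The number of steps is chosen after the Taylor constant,
    so the roughness of the minorant does not enter the final bound. The truncated potential is
    continuous only because [W 0 = +oo]. This has to be proved, since a generalised Laplacian equal
    to [-oo] is compatible with a finite value (take -|x|). The distance to [x_k] balances two
    errors: at squared distance about t, the mean value inequality costs O(t) and the
    self-interaction O(t^((2-beta)/2) / N); both are O(N^(-2/beta)) for t of order N^(-2/beta).
    Second moments of balls are only estimated, by means of cubes; the resulting factors 8 d^3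
    affect [A] alone. *)

Definition box n (A : 'I_n -> set (measurableTypeR R)) : set 'rV[R]_n :=
  [set x | forall i, A i (x ord0 i)].

Lemma measurable_box n (A : 'I_n -> set (measurableTypeR R)) :
  (forall i, measurable (A i)) -> measurable (box A).
Proof.
move=> mA; rewrite [X in measurable X](_ : _ =
    \big[setI/setT]_(i < n) (@rV_coord R n i @^-1` A i)); last first.
  rewrite -bigcap_seq; apply/seteqP; split => [x xA i _|x xA i]; first exact: xA.
  by apply: (xA i); rewrite /= mem_index_enum.
apply: bigsetI_measurable => i _; rewrite -[X in measurable X]setTI.
exact: measurable_rV_coord.
Qed.

Lemma measurable_rV_boxes n :
  @measurable _ 'rV[R]_n =
  <<s [set B | exists2 A, (forall i, measurable (A i)) & B = box A] >>.
Proof.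
apply/seteqP; split; last first.
  apply: smallest_sub; first exact: sigma_algebra_measurable.
  by move=> B [A mA ->]; exact: measurable_box.
apply: smallest_sub; first exact: smallest_sigma_algebra.
rewrite -bigcup_seq; apply: bigcup_sub => i _.
move=> _ [B mB <-]; apply: sub_gen_smallest.
exists (fun j => if j == i then B else setT).
  by move=> j; case: ifP => // _; exact: measurableT.
rewrite setTI; apply/seteqP; split => x /=.
  by move=> xB j; case: ifPn => // /eqP ->.
by move=> /(_ i); rewrite eqxx.
Qed.

(** Boxes form a generating pi-system, and the cubes [I k] exhaust the space with finite measure, so
    a measure is determined by its values on boxes. *)
Lemma lebesgue_rV_invariant n (g : 'rV[R]_n -> 'rV[R]_n) :
  measurable_fun setT g ->
  (forall A, (forall i, measurable (A i)) -> exists A',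
    [/\ forall i, measurable (A' i), g @^-1` box A = box A' &
      (\prod_(i < n) lebesgue_measure (A' i) =
       \prod_(i < n) lebesgue_measure (A i))%E]) ->
  forall B, measurable B -> lebesgue_rV n (g @^-1` B) = lebesgue_rV n B.
Proof.
move=> mg gbox B mB; apply/esym.
pose mu' : {measure set 'rV[R]_n -> \bar R} := pushforward (lebesgue_rV n) g.
pose I k : set (measurableTypeR R) := `](- k%:R : R), (k%:R : R)[%classic.
have := @measure_unique _ R _ _ (fun k => box (fun=> I k))
  (@measurable_rV_boxes n) _ _ _ (lebesgue_rV n) (mu' mg).
apply => //.
- move=> _ _ [A mA ->] [A' mA' ->]; exists (fun i => A i `&` A' i).
    by move=> i; exact: measurableI.
  apply/seteqP; split => x /=; first by case=> xA xA' i; split.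
  by move=> xAA'; split=> i; case: (xAA' i).
- by move=> k; exists (fun=> I k) => // i; exact: measurable_itv.
- apply/seteqP; split=> // x _ /=.
  have [N xN] : exists N : nat, forall i, `|x ord0 i| < N%:R.
    exists (Num.truncn (\sum_i `|x ord0 i|)).+1 => i.
    apply: le_lt_trans (truncnS_gt _).
    by rewrite (bigD1 i)//= lerDl sumr_ge0.
  exists N => // i; rewrite /I/= in_itv/= -ltr_norml; exact: xN.
- move=> _ [A mA ->]; rewrite /mu'/= /pushforward.
  have [A' [mA' gA' e]] := gbox A mA.
  transitivity (lebesgue_rV n (box A')); last by rewrite -gA'.
  exact: etrans (lebesgue_rV_box mA) (etrans (esym e) (esym (lebesgue_rV_box mA'))).
- move=> k; have mI (i : 'I_n) : measurable (I k) by exact: measurable_itv.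
  have /= -> := lebesgue_rV_box mI.
  rewrite (eq_bigr (fun=> ((k%:R + k%:R : R)%:E))); last first.
    move=> i _; rewrite lebesgue_measure_itv/= lte_fin opprK.
    case: ltP => // kk; congr (_%:E); apply/esym/eqP.
    by rewrite eq_le addr_ge0// andbT -lerBrDr sub0r.
  by rewrite prodEFin ltry.
Qed.

(** Sign changes will cancel the odd terms in averages over balls, and permutations will equate the
    second moments of the coordinates. *)
Lemma lebesgue_rV_signed_perm n (s : 'I_n -> bool) (p : 'S_n) B :
  measurable B ->
  lebesgue_rV n ((fun x : 'rV[R]_n => \row_i ((-1) ^+ s i * x ord0 (p i))) @^-1` B)
  = lebesgue_rV n B.
Proof.
apply: lebesgue_rV_invariant.
  apply/measurable_fun_rVP => i.
  rewrite (_ : _ \o _ = (fun x => (-1) ^+ s i * rV_coord (p i) x)).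
    by apply: measurable_funM => //; exact: measurable_rV_coord.
  by apply/funext => x; rewrite /rV_coord/= mxE.
move=> A mA.
have mN (C : set (measurableTypeR R)) : measurable C ->
    measurable ((-%R : measurableTypeR R -> measurableTypeR R) @^-1` C).
  move=> mC; rewrite -[X in measurable X]setTI.
  by apply: (@oppr_measurable R setT) => //; exact: measurableT.
pose A' i := (fun t : measurableTypeR R => (-1) ^+ s (p^-1%g i) * t : measurableTypeR R)
  @^-1` A (p^-1%g i).
have A'E i : A' i = if s (p^-1%g i) then -%R @^-1` A (p^-1%g i) else A (p^-1%g i).
  by rewrite /A'; case: ifP => _; apply/funext => t /=;
    rewrite ?expr1 ?expr0 ?mul1r ?mulN1r.
exists A'; split.
- by move=> i; rewrite A'E; case: ifP => // _; exact: mN.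
- apply/seteqP; split => x /= xA i.
    by have := xA (p^-1%g i); rewrite mxE permKV.
  by have := xA (p i); rewrite mxE /A'/= permK.
- rewrite (reindex_inj (@perm_inj _ p))/=; apply: eq_bigr => i _.
  rewrite A'E permK; case: ifP => // _.
  exact: (lebesgue_measureN (mA i)).
Qed.

End lebesgue_rV_invariance.

(** * Integrals over Euclidean balls *)

Section ball_integrals.
Context {R : realType} {d : nat}.
Implicit Types (x y : 'rV[R]_d) (f g : 'rV[R]_d -> R).

Definition signed_perm (s : 'I_d -> bool) (p : 'S_d) x : 'rV[R]_d :=
  \row_i ((-1) ^+ s i * x ord0 (p i)).

Definition flip (s : 'I_d -> bool) x : 'rV[R]_d :=
  \row_i ((-1) ^+ s i * x ord0 i).

(** Averaging over all sign changes preserves integrals over balls ([bint_symmetrise]) and removes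
    every monomial that is odd in some coordinate. *)
Definition symmetrise f x : R :=
  (2 ^+ d)^-1 * \sum_(s : {ffun 'I_d -> bool}) f (flip s x).

Lemma flipE s : flip s = signed_perm s 1.
Proof. by apply/funext => x; apply/rowP => i; rewrite !mxE perm1. Qed.

Lemma enorm_ge0 x : 0 <= enorm x. Proof. exact: sqrtr_ge0. Qed.

Lemma enorm_sqr x : enorm x ^+ 2 = \sum_i x ord0 i ^+ 2.
Proof. by rewrite sqr_sqrtr// sumr_ge0// => i _; exact: sqr_ge0. Qed.

Lemma enorm_lt x r : 0 < r -> (enorm x < r) = (\sum_i x ord0 i ^+ 2 < r ^+ 2).
Proof. by move=> r0; rewrite -enorm_sqr ltr_pXn2r// nnegrE ?enorm_ge0// ltW. Qed.

Lemma ler_coord_enorm x i : `|x ord0 i| <= enorm x.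
Proof.
rewrite -(@ler_pXn2r _ 2%N)// ?nnegrE ?enorm_ge0// enorm_sqr real_normK ?num_real//.
by rewrite (bigD1 i)//= lerDl sumr_ge0// => j _; exact: sqr_ge0.
Qed.

Lemma enorm_signed_perm s p x : enorm (signed_perm s p x) = enorm x.
Proof.
congr Num.sqrt; rewrite [RHS](reindex_inj (@perm_inj _ p))/=.
by apply: eq_bigr => i _; rewrite mxE exprMn sqrr_sign mul1r.
Qed.

Lemma measurable_signed_perm s p : measurable_fun setT (signed_perm s p).
Proof.
apply/measurable_fun_rVP => i.
rewrite (_ : _ \o _ = (fun x => (-1) ^+ s i * rV_coord (p i) x)).
  by apply: measurable_funM => //; exact: measurable_rV_coord.
by apply/funext => x; rewrite /rV_coord/= mxE.
Qed.

Lemma measurable_coord i : measurable_fun setT (fun x : 'rV[R]_d => x ord0 i).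
Proof. exact: measurable_rV_coord. Qed.

Lemma measurable_eball r : measurable (@eball R d r).
Proof.
have [r0|r0] := ltP 0 r; last first.
  rewrite (_ : eball r = set0)//; apply/seteqP; split => // x /= /lt_le_trans.
  by move=> /(_ _ r0); rewrite ltNge enorm_ge0.
rewrite (_ : eball r = [set x | \sum_i x ord0 i ^+ 2 < r ^+ 2]); last first.
  by apply/seteqP; split => x; rewrite /eball/= enorm_lt.
have ms : measurable_fun setT (fun x : 'rV[R]_d => \sum_i x ord0 i ^+ 2).
  apply: measurable_sum => i; apply: measurable_funX; exact: measurable_coord.
rewrite -[X in measurable X]setTI.
have := ms measurableT `]-oo, r ^+ 2[%classic (measurable_itv _).
congr (measurable _); apply/seteqP; split => x /=; rewrite in_itv/=; case=> //.
Qed.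

Lemma eball_signed_perm s p r : signed_perm s p @^-1` eball r = eball r.
Proof. by apply/seteqP; split => x; rewrite /eball/= enorm_signed_perm. Qed.

Definition cube (r : R) : set 'rV[R]_d :=
  box (fun=> (`](- r), r[%classic : set (measurableTypeR R))).

Lemma eball_sub_cube r :
  @eball R d r `<=` cube r.
Proof.
move=> x xr i /=; rewrite in_itv/= -ltr_norml.
exact: le_lt_trans (ler_coord_enorm _ _) xr.
Qed.

Lemma cube_sub_eball r : 0 < r -> (0 < d)%N ->
  cube (r / d%:R) `<=` @eball R d r.
Proof.
move=> r0 d0 x xb; rewrite /eball/= enorm_lt//.
have dR : 0 < d%:R :> R by rewrite ltr0n.
apply: (@lt_le_trans _ _ (\sum_(i < d) (r / d%:R) ^+ 2)).
  apply: ltr_sum => [|i _].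
    by apply/hasP; exists (Ordinal d0) => //; rewrite mem_index_enum.
  have := xb i; rewrite /= in_itv/= -ltr_norml => xi.
  by rewrite -(@real_normK _ (x ord0 i)) ?num_real// ltr_pXn2r// ?nnegrE//
    divr_ge0// ltW.
rewrite sumr_const card_ord -[leLHS]mulr_natr expr_div_n -mulrA ler_piMr ?sqr_ge0//.
rewrite expr2 invfM -mulrA mulVf ?gt_eqF// mulr1 invf_le1//.
by rewrite ler1n.
Qed.

Lemma lebesgue_rV_cube r : 0 <= r ->
  lebesgue_rV d (cube r) = ((r *+ 2) ^+ d)%:E.
Proof.
move=> r0; have mI (i : 'I_d) : measurable (`](- r), r[%classic : set (measurableTypeR R)).
  exact: measurable_itv.
rewrite (lebesgue_rV_box mI) (eq_bigr (fun=> (r *+ 2)%:E)); last first.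
  move=> i _; rewrite lebesgue_measure_itv/= lte_fin opprK mulr2n.
  case: ltP => // rr; congr (_%:E); apply/eqP; rewrite eq_sym.
  by rewrite eq_le addr_ge0// andbT -lerBrDr sub0r.
by rewrite prodEFin prodr_const card_ord.
Qed.

Definition vball r : R := fine (lebesgue_rV d (@eball R d r)).

Lemma measurable_cube r :
  measurable (cube r).
Proof. by apply: measurable_box => i; exact: measurable_itv. Qed.

Lemma lebesgue_eball_lty r : (lebesgue_rV d (@eball R d r) < +oo)%E.
Proof.
have [r0|r0] := leP 0 r; last first.
  rewrite (_ : eball r = set0) ?measure0//; apply/seteqP; split => // x /= /lt_trans.
  by move=> /(_ _ r0); rewrite ltNge enorm_ge0.
apply: le_lt_trans (ltry ((r *+ 2) ^+ d)); rewrite -lebesgue_rV_cube//.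
apply: le_measure; rewrite ?inE; [exact: measurable_eball|exact: measurable_cube|].
exact: eball_sub_cube.
Qed.

Lemma vballE r : lebesgue_rV d (@eball R d r) = (vball r)%:E.
Proof. by rewrite fineK// ge0_fin_numE// lebesgue_eball_lty. Qed.

Lemma vball_gt0 r : (0 < d)%N -> 0 < r -> 0 < vball r.
Proof.
move=> d0 r0; rewrite -lte_fin -vballE.
have dR : 0 < d%:R :> R by rewrite ltr0n.
apply: (@lt_le_trans _ _ (((r / d%:R) *+ 2) ^+ d)%:E).
  by rewrite lte_fin exprn_gt0// pmulrn_rgt0// divr_gt0.
rewrite -lebesgue_rV_cube; last by rewrite divr_ge0// ltW.
apply: le_measure; rewrite ?inE; [exact: measurable_cube|exact: measurable_eball|].
exact: cube_sub_eball.
Qed.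

(** The small ball lies in a cube of side r/d and the large one contains a cube of side 2r/d; the
    volumes of these cubes differ by the factor 2^d, at least 2. *)
Lemma vball_half r : (0 < d)%N -> 0 < r -> vball (r / (2 * d%:R)) <= vball r / 2.
Proof.
move=> d0 r0.
have dR : 0 < d%:R :> R by rewrite ltr0n.
have r'0 : 0 <= r / (2 * d%:R) by rewrite divr_ge0 ?mulr_ge0 ?ltW.
have h1 : vball (r / (2 * d%:R)) <= (r / (2 * d%:R) *+ 2) ^+ d.
  rewrite -lee_fin -vballE -lebesgue_rV_cube//.
  apply: le_measure; rewrite ?inE; [exact: measurable_eball|exact: measurable_cube|].
  exact: eball_sub_cube.
have h2 : ((r / d%:R) *+ 2) ^+ d <= vball r.
  rewrite -lee_fin -vballE -lebesgue_rV_cube; last by rewrite divr_ge0// ltW.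
  apply: le_measure; rewrite ?inE; [exact: measurable_cube|exact: measurable_eball|].
  exact: cube_sub_eball.
apply: (le_trans h1); rewrite ler_pdivlMr//; apply: le_trans h2.
have -> : r / d%:R *+ 2 = 2 * (r / (2 * d%:R) *+ 2).
  by rewrite !mulr2n; field; rewrite gt_eqF.
rewrite exprMn mulrC ler_wpM2r ?exprn_ge0 ?mulrn_wge0//.
by case: d d0 => // n _; rewrite exprS ler_peMr// exprn_ege1// ler1n.
Qed.

Definition ball_bounded r f :=
  measurable_fun setT f /\ exists M, forall y, eball r y -> `|f y| <= M.

Lemma ball_bounded_integrable r f : ball_bounded r f ->
  (lebesgue_rV d).-integrable (eball r) (EFin \o f).
Proof.
move=> [mf [M fM]]; apply: measurable_bounded_integrable.
- exact: measurable_eball.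
- exact: lebesgue_eball_lty.
- exact: measurable_funTS.
- by exists M; split; [exact: num_real|move=> N MN y /fM /le_trans; apply; exact: ltW].
Qed.

Definition bint r f : R := (\int[lebesgue_rV d]_(y in eball r) f y).

Lemma bintD r f g : ball_bounded r f -> ball_bounded r g ->
  bint r (fun y => f y + g y) = bint r f + bint r g.
Proof.
move=> bf bg; apply: RintegralD; first exact: measurable_eball.
  exact: ball_bounded_integrable.
exact: ball_bounded_integrable.
Qed.

Lemma bintZ r f a : ball_bounded r f -> bint r (fun y => a * f y) = a * bint r f.
Proof.
move=> bf; apply: RintegralZl; first exact: measurable_eball.
exact: ball_bounded_integrable.
Qed.

Lemma bint_cst r a : bint r (fun=> a) = a * vball r.
Proof. by apply: Rintegral_cst; exact: measurable_eball. Qed.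

Lemma le_bint r f g : ball_bounded r f -> ball_bounded r g ->
  (forall y, eball r y -> f y <= g y) -> bint r f <= bint r g.
Proof.
move=> bf bg; apply: le_Rintegral; first exact: measurable_eball.
  exact: ball_bounded_integrable.
exact: ball_bounded_integrable.
Qed.

Lemma ball_bounded_cst r a : ball_bounded r (fun=> a).
Proof. by split; [exact: measurable_cst|exists `|a|]. Qed.

Lemma ball_boundedD r f g : ball_bounded r f -> ball_bounded r g ->
  ball_bounded r (fun y => f y + g y).
Proof.
move=> [mf [M fM]] [mg [M' gM']]; split; first exact: measurable_funD.
exists (M + M') => y yr; apply: le_trans (ler_normD _ _) _.
by rewrite lerD ?fM ?gM'.
Qed.

Lemma ball_boundedM r f g : ball_bounded r f -> ball_bounded r g ->
  ball_bounded r (fun y => f y * g y).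
Proof.
move=> [mf [M fM]] [mg [M' gM']]; split; first exact: measurable_funM.
exists (M * M') => y yr; rewrite normrM.
by rewrite ler_pM ?fM ?gM'.
Qed.

Lemma ball_bounded_sum r (I : Type) (s : seq I) (F : I -> 'rV[R]_d -> R) :
  (forall i, ball_bounded r (F i)) ->
  ball_bounded r (fun y => \sum_(i <- s) F i y).
Proof.
move=> bF; elim: s => [|i s IH].
  by under eq_fun do rewrite big_nil; exact: ball_bounded_cst.
by under eq_fun do rewrite big_cons; exact: ball_boundedD.
Qed.

Lemma bint_sum r (I : Type) (s : seq I) (F : I -> 'rV[R]_d -> R) :
  (forall i, ball_bounded r (F i)) ->
  bint r (fun y => \sum_(i <- s) F i y) = \sum_(i <- s) bint r (F i).
Proof.
move=> bF; elim: s => [|i s IH].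
  by under eq_fun do rewrite big_nil; rewrite big_nil bint_cst mul0r.
under eq_fun do rewrite big_cons; rewrite big_cons bintD ?IH//.
exact: ball_bounded_sum.
Qed.

Lemma ball_bounded_coord r i : ball_bounded r (fun y => y ord0 i).
Proof.
split; first exact: measurable_coord.
exists r => y yr; exact: le_trans (ler_coord_enorm _ _) (ltW yr).
Qed.

Lemma ball_bounded_signed_perm r s p f : ball_bounded r f ->
  ball_bounded r (f \o signed_perm s p).
Proof.
move=> [mf [M fM]]; split.
  by apply: measurableT_comp => //; exact: measurable_signed_perm.
by exists M => y yr; apply: fM; rewrite /eball/= enorm_signed_perm.
Qed.

Lemma bint_signed_perm r s p f : ball_bounded r f ->
  bint r (f \o signed_perm s p) = bint r f.
Proof.
move=> bf; congr fine.
have mg := measurable_signed_perm s p.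
transitivity (\int[lebesgue_rV d]_(x in signed_perm s p @^-1` eball r)
    ((EFin \o f) \o signed_perm s p) x)%E; first by rewrite eball_signed_perm.
rewrite -integral_pushforward//.
- apply: eq_measure_integral => A mA _.
  exact: lebesgue_rV_signed_perm.
- by apply/measurable_EFinP; case: bf.
- rewrite eball_signed_perm.
  exact: (ball_bounded_integrable (ball_bounded_signed_perm s p bf)).
- exact: measurable_eball.
Qed.

Lemma ball_bounded_flips r f : ball_bounded r f ->
  ball_bounded r (fun y => \sum_(s : {ffun 'I_d -> bool}) f (flip s y)).
Proof.
move=> bf; apply: ball_bounded_sum => s.
by rewrite flipE; exact: ball_bounded_signed_perm.
Qed.

Lemma bint_symmetrise r f : ball_bounded r f -> bint r (symmetrise f) = bint r f.
Proof.
move=> bf; rewrite /symmetrise bintZ; last exact: ball_bounded_flips.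
rewrite bint_sum; last first.
  by move=> s; rewrite flipE; exact: ball_bounded_signed_perm.
rewrite (eq_bigr (fun=> bint r f)) => [|s _]; last first.
  by rewrite flipE -[RHS](bint_signed_perm s 1).
rewrite sumr_const card_ffun card_bool card_ord -[_ *+ (2 ^ d)]mulr_natl natrX mulKf//.
Qed.

Lemma ball_bounded_coord2 r i : ball_bounded r (fun y => y ord0 i ^+ 2).
Proof.
have := ball_boundedM (ball_bounded_coord r i) (ball_bounded_coord r i).
by under eq_fun do rewrite -expr2.
Qed.

Lemma bint_coord2 r i j :
  bint r (fun y => y ord0 i ^+ 2) = bint r (fun y => y ord0 j ^+ 2).
Proof.
rewrite -(@bint_signed_perm _ (fun=> false) (tperm i j) (fun y => y ord0 i ^+ 2)).
  by congr bint; apply/funext => y /=; rewrite mxE expr0 mul1r tpermL.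
exact: ball_bounded_coord2.
Qed.

Lemma bint_coord2_le r i : 0 < r ->
  bint r (fun y => y ord0 i ^+ 2) <= r ^+ 2 * vball r.
Proof.
move=> r0; rewrite -bint_cst; apply: le_bint.
- exact: ball_bounded_coord2.
- exact: ball_bounded_cst.
- move=> y yr; rewrite -(@real_normK _ (y ord0 i)) ?num_real//.
  rewrite ler_pXn2r// ?nnegrE// ?ltW//.
  exact: le_lt_trans (ler_coord_enorm _ _) yr.
Qed.

(* At least half of the mass of the ball of radius r lies outside the ball of
   radius r / 2d, by comparison of inscribed and circumscribed cubes. *)
Lemma bint_coord2_ge r i : 0 < r ->
  (8 * d%:R ^+ 3)^-1 * r ^+ 2 * vball r <= bint r (fun y => y ord0 i ^+ 2).
Proof.
move=> r0; have d0 : (0 < d)%N by exact: leq_ltn_trans (ltn_ord i).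
have dR : 0 < d%:R :> R by rewrite ltr0n.
pose t := r / (2 * d%:R).
have t0 : 0 < t by rewrite divr_gt0// mulr_gt0.
have tr : t <= r.
  by rewrite ler_pdivrMr ?mulr_gt0// ler_peMr ?(ltW r0)// mulr_ege1// ler1n.
have mI : measurable_fun setT (\1_(@eball R d t) : 'rV[R]_d -> R).
  by apply/measurable_indicP; exact: measurable_eball.
have bI : ball_bounded r (\1_(@eball R d t) : 'rV[R]_d -> R).
  by split => //; exists 1 => y _; rewrite indicE normr_nat lern1 leq_b1.
have bIE : bint r (\1_(@eball R d t)) = vball t.
  rewrite /bint /Rintegral integral_indic//; [|exact: measurable_eball..].
  congr (fine (lebesgue_rV d _)); apply/seteqP; split => y; first by case.
  by move=> yt; split => //; exact: lt_le_trans yt tr.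
have : bint r (fun y => t ^+ 2 - t ^+ 2 * \1_(@eball R d t) y) <=
    bint r (fun y => \sum_(j < d) y ord0 j ^+ 2).
  apply: le_bint.
  - under eq_fun do rewrite -mulNr.
    apply: ball_boundedD; first exact: ball_bounded_cst.
    by apply: ball_boundedM => //; exact: ball_bounded_cst.
  - by apply: ball_bounded_sum => j; exact: ball_bounded_coord2.
  - move=> y yr; rewrite indicE; have [yt|yt] := boolP (y \in eball t).
      by rewrite mulr1 subrr sumr_ge0// => j _; exact: sqr_ge0.
    rewrite mulr0 subr0 leNgt -(enorm_lt y t0).
    by move: yt; rewrite notin_setE => /negP.
rewrite bint_sum; last by move=> j; exact: ball_bounded_coord2.
rewrite (eq_bigr (fun=> bint r (fun y => y ord0 i ^+ 2))) => [|j _]; last first.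
  exact: bint_coord2.
rewrite sumr_const card_ord -[X in _ <= X -> _]mulr_natl.
rewrite (_ : (fun y => _ - _) = (fun y => t ^+ 2 + - t ^+ 2 * \1_(@eball R d t) y));
  last by apply/funext => y; rewrite mulNr.
rewrite bintD; [|exact: ball_bounded_cst|]; last first.
  by apply: ball_boundedM => //; exact: ball_bounded_cst.
rewrite bint_cst bintZ// bIE => h.
have vt := vball_half d0 r0; rewrite -/t in vt.
have : t ^+ 2 * (vball r / 2) <= d%:R * bint r (fun y => y ord0 i ^+ 2).
  apply: le_trans h; rewrite mulNr -mulrBr ler_wpM2l ?sqr_ge0//.
  by rewrite lerBrDr (le_trans (lerD (lexx _) vt))// -splitr.
rewrite -ler_pdivrMl//; apply: le_trans; rewrite le_eqVlt; apply/orP; left.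
by apply/eqP; rewrite /t; field; rewrite gt_eqF.
Qed.

End ball_integrals.
Arguments vball {R} d r.

(** * Touching from below *)

Section touching.
Context {R : realType} {d : nat}.
Implicit Types (x y : 'rV[R]_d) (W : 'rV[R]_d -> \bar R) (q : 'rV[R]_d -> R).

Lemma coord_compact (M : R) : compact [set x : 'rV[R]_d | forall i, `|x ord0 i| <= M].
Proof.
rewrite (_ : [set _ | _] =
  [set v : 'rV[R]_d | forall i, `[- M, M]%classic (v ord0 i)]).
  by apply: (@rV_compact _ _ (fun=> `[- M, M]%classic)) => _; exact: segment_compact.
by apply/seteqP; split => x /= xM i; move: (xM i); rewrite ?in_itv/= ler_norml.
Qed.

Lemma measurable_translate (x : 'rV[R]_d) : measurable_fun setT (fun y => x + y).
Proof.
apply/measurable_fun_rVP => i.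
rewrite (_ : _ \o _ = (fun y => x ord0 i + y ord0 i)).
  by apply: measurable_funD => //; exact: measurable_coord.
by apply/funext => y; rewrite /rV_coord/= mxE.
Qed.

(** Measurability comes from integrability on a compact cube that contains the translated ball. *)
Lemma locint_measurable W x r : locally_integrable_rV W ->
  measurable_fun (eball r) (fun y => W (x + y)).
Proof.
move=> Wloc; pose M := \sum_i `|x ord0 i| + `|r|.
pose K := box (fun _ : 'I_d => (`[- M, M]%classic : set (measurableTypeR R))).
have cK : compact K.
  by apply: (@rV_compact _ _ (fun=> `[- M, M]%classic)) => _; exact: segment_compact.
have mK : measurable K by apply: measurable_box => i; exact: measurable_itv.
apply: (@measurable_comp _ _ _ _ _ _ K) => //.
- move=> _ /= [y yr <-] i /=; rewrite in_itv/= -ler_norml mxE.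
  apply: le_trans (ler_normD _ _) _; apply: lerD.
    by rewrite (bigD1 i)//= lerDl sumr_ge0.
  by rewrite (le_trans (ler_coord_enorm _ _))// (le_trans (ltW yr))// ler_norm.
- exact: measurable_int (Wloc _ cK).
- exact: measurable_funTS (measurable_translate x).
Qed.

(** The integral of [g] may be infinite, so positive and negative parts are compared separately. *)
Lemma bint_le_integral r f (g : 'rV[R]_d -> \bar R) : ball_bounded r f ->
  measurable_fun (eball r) g -> (forall y, eball r y -> ((f y)%:E <= g y)%E) ->
  ((bint r f)%:E <= \int[lebesgue_rV d]_(y in eball r) g y)%E.
Proof.
move=> bf mg fg; have mB := @measurable_eball R d r.
have fi := ball_bounded_integrable bf.
rewrite /bint /Rintegral fineK; last exact: integrable_fin_num.
have mf : measurable_fun (eball r) (EFin \o f) by exact: measurable_int fi.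
rewrite integralE [leRHS]integralE; apply: leeB.
- apply: ge0_le_integral => //; [exact: measurable_funepos..|].
  by move=> y yr; apply: (@funepos_le _ _ (eball r)); rewrite ?inE// => z; rewrite inE; exact: fg.
- apply: ge0_le_integral => //; [exact: measurable_funeneg..|].
  by move=> y yr; apply: (@funeneg_le _ _ (eball r)); rewrite ?inE// => z; rewrite inE; exact: fg.
Qed.

Lemma limf_einf_right_ge (f : R -> \bar R) (L C : R) :
  (exists2 e0, 0 < e0 & forall e, 0 < e < e0 -> ((L - C * e)%:E <= f e)%E) ->
  (L%:E <= limf_einf f 0^'+)%E.
Proof.
move=> [e0 e00 fL]; rewrite limf_einfE; apply/lee_addgt0Pr => h h0.
have C1 : 0 < `|C| + 1 by rewrite ltr_wpDl.
pose e1 := Num.min e0 (h / (`|C| + 1)).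
have e10 : 0 < e1 by rewrite lt_min e00 divr_gt0.
pose V := [set e | 0 < e < e1].
apply: (@le_trans _ _ (ereal_inf (f @` V) + h%:E)%E).
  rewrite -leeBlDr//; apply: le_ereal_inf_tmp => _ [e /= /andP[e_gt0 ee1] <-].
  apply: le_trans (fL e _); last first.
    by rewrite e_gt0 (lt_le_trans ee1)// ge_min lexx.
  rewrite -EFinB lee_fin lerB// ltW//; apply: le_lt_trans (ler_norm _) _.
  rewrite normrM (gtr0_norm e_gt0).
  apply: (@lt_trans _ _ ((`|C| + 1) * e)); first by rewrite ltr_pM2r// ltrDl.
  by rewrite -ltr_pdivlMl// mulrC (lt_le_trans ee1)// ge_min lexx orbT.
apply: leeD => //; apply: ereal_sup_ubound; exists V => //.
near=> e => /=; apply/andP; split; near: e; first exact: nbhs_right_gt.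
exact: nbhs_right_lt.
Unshelve. all: by end_near. Qed.

(** Averaging the touching function bounds the average of [W] from below. The exact second moment
    e^2 |B_e| / (d+2) would give the sum of the [D i]; the two cube estimates of that moment give
    two multiples of the sum, and the minimum is the one valid for its sign. *)
Lemma laplacian0_touch W x0 w q (D : 'I_d -> R) K r0 :
  (0 < d)%N -> 0 < r0 -> locally_integrable_rV W -> W x0 = w%:E ->
  ball_bounded r0 q ->
  (forall y, eball r0 y -> ((w + q y)%:E <= W (x0 + y)%R)%E) ->
  (forall y r, 0 <= r -> r <= 1 -> (forall i, `|y ord0 i| <= r) ->
     2^-1 * (\sum_i D i * y ord0 i ^+ 2) - K * r ^+ 3 <= symmetrise q y) ->
  (((d%:R + 2) * Num.min ((\sum_i D i) / (8 * d%:R ^+ 3)) (\sum_i D i))%:E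
    <= laplacian0 W x0)%E.
Proof.
move=> d0 r00 Wloc Wx0 [mq [M qM]] qW qD.
set s := \sum_i D i; set L := _ * _.
apply: (@limf_einf_right_ge _ _ (2 * (d%:R + 2) * K)).
exists (Num.min r0 1); first by rewrite lt_min r00 ltr01.
move=> e /andP[e0]; rewrite lt_min => /andP[er0 e1].
have bq : ball_bounded e q.
  by split => //; exists M => y ye; apply: qM; exact: lt_trans ye er0.
have ve := vball_gt0 d0 e0.
rewrite /laplacian_eps Wx0/= -/(vball d e).
set I := (\int[_]_(_ in _) _)%E.
have hI : ((w * vball d e + bint e q)%:E <= I)%E.
  rewrite -bint_cst -bintD//; last exact: ball_bounded_cst.
  apply: bint_le_integral.
  - by apply: ball_boundedD => //; exact: ball_bounded_cst.
  - exact: locint_measurable.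
  - by move=> y ye; apply: qW; exact: lt_trans ye er0.
have i0 : 'I_d by exact: Ordinal d0.
pose m := bint e (fun y => y ord0 i0 ^+ 2).
have hq : 2^-1 * (s * m) - K * e ^+ 3 * vball d e <= bint e q.
  rewrite -(bint_symmetrise bq).
  have bD : ball_bounded e (fun y => \sum_i D i * y ord0 i ^+ 2).
    apply: ball_bounded_sum => i; apply: ball_boundedM.
      exact: ball_bounded_cst.
    exact: ball_bounded_coord2.
  have bsq : ball_bounded e (symmetrise q).
    apply: ball_boundedM; first exact: ball_bounded_cst.
    exact: ball_bounded_flips.
  apply: (@le_trans _ _ (bint e (fun y => 2^-1 * (\sum_i D i * y ord0 i ^+ 2)
      + - (K * e ^+ 3)))); last first.
    apply: le_bint => //.
      apply: ball_boundedD; last exact: ball_bounded_cst.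
      by apply: ball_boundedM => //; exact: ball_bounded_cst.
    move=> y ye; apply: qD; rewrite ?ltW// => i.
    exact: le_trans (ler_coord_enorm _ _) (ltW ye).
  rewrite bintD; last 2 first.
    by apply: ball_boundedM => //; exact: ball_bounded_cst.
    exact: ball_bounded_cst.
  rewrite bintZ// bint_cst mulNr lerD2r ler_wpM2l ?invr_ge0//.
  rewrite bint_sum; last first.
    move=> i; apply: ball_boundedM; first exact: ball_bounded_cst.
    exact: ball_bounded_coord2.
  rewrite mulr_suml ler_sum// => i _.
  by rewrite bintZ ?(bint_coord2 e i i0)//; exact: ball_bounded_coord2.
have hm : 2^-1 * (e ^+ 2 * vball d e * (L / (d%:R + 2))) <= 2^-1 * (s * m).
  rewrite ler_wpM2l ?invr_ge0//.
  have -> : L / (d%:R + 2) = Num.min (s / (8 * d%:R ^+ 3)) s.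
    by rewrite /L mulrC mulKf// gt_eqF// ltr_wpDl.
  have m1 : m <= e ^+ 2 * vball d e by exact: bint_coord2_le.
  have m2 : (8 * d%:R ^+ 3)^-1 * e ^+ 2 * vball d e <= m by exact: bint_coord2_ge.
  have p0 : 0 <= e ^+ 2 * vball d e by rewrite mulr_ge0 ?sqr_ge0// ltW.
  have [s0|s0] := leP 0 s.
    apply: (@le_trans _ _ (e ^+ 2 * vball d e * (s / (8 * d%:R ^+ 3)))).
      by rewrite ler_wpM2l// ge_min lexx.
    rewrite mulrCA ler_wpM2l// mulrC; apply: le_trans m2.
    by rewrite mulrA.
  apply: (@le_trans _ _ (e ^+ 2 * vball d e * s)).
    by rewrite ler_wpM2l// ge_min lexx orbT.
  by rewrite mulrC ler_wnM2l// ltW.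
apply: (@le_trans _ _ ((2 * (d%:R + 2) / e ^+ 2)%:E *
  ((vball d e)^-1%:E * (w * vball d e + bint e q)%:E - w%:E))%E); last first.
  apply: lee_wpmul2l; first by rewrite lee_fin divr_ge0 ?sqr_ge0// mulr_ge0// addr_ge0.
  apply: leeD => //; apply: lee_wpmul2l => //.
  by rewrite lee_fin invr_ge0 ltW.
rewrite -!EFinM lee_fin.
have -> : (vball d e)^-1 * (w * vball d e + bint e q) - w = bint e q / vball d e.
  by field; rewrite gt_eqF.
rewrite [leRHS]mulrAC ler_pdivlMr ?exprn_gt0// -ler_pdivrMl ?mulr_gt0 ?ltr_wpDl//.
rewrite ler_pdivlMr//; apply: le_trans hq; apply: le_trans (lerD hm (lexx _)).
rewrite le_eqVlt; apply/orP; left; apply/eqP.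
by field; rewrite gt_eqF// ltr_wpDl.
Qed.

End touching.

(** * Minima of lower semicontinuous functions *)

Section lower_semicontinuity.
Context {R : realType} {T : topologicalType}.
Local Open Scope ereal_scope.

Lemma ereal_between (x y : \bar R) : x < y -> exists r : R, x < r%:E /\ r%:E < y.
Proof.
move: x y => [x| |] [y| |]//.
- rewrite lte_fin => xy; exists ((x + y) / 2)%R.
  by rewrite !lte_fin !midf_lt.
- by move=> _; exists (x + 1)%R; rewrite lte_fin ltrDl ltr01 ltry.
- by move=> _; exists (y - 1)%R; rewrite lte_fin ltrBlDr ltrDl ltr01 ltNyr.
- by move=> _; exists 0%R; rewrite ltry ltNyr.
Qed.

(** The sublevel sets above the infimum form a filter on [K]. By lower semicontinuity, a cluster
    point of it cannot have a value above the infimum. *)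
Lemma lsc_compact_min (g : T -> \bar R) (K : set T) :
  lower_semicontinuous g -> compact K -> K !=set0 ->
  exists2 x0, K x0 & forall y, K y -> g x0 <= g y.
Proof.
move=> gl cK [z Kz]; pose m := ereal_inf (g @` K).
have mg y : K y -> m <= g y by move=> Ky; apply: ereal_inf_lbound; exists y.
(* With infimum [+oo] there is no level above it, and the filter below would have no base. *)
have [moo|moo] := eqVneq m +oo.
  exists z => // y Ky; have := mg y Ky; rewrite moo leye_eq => /eqP ->.
  by rewrite leey.
pose B a := K `&` [set x | g x < a].
pose F := filter_from [set a | m < a] B.
have FF : ProperFilter F.
  apply: filter_from_proper; last first.
    by move=> a /= /ereal_inf_lt[_ [x Kx <-] xa]; exists x.
  apply: filter_from_filter; first by exists +oo; rewrite /= ltey.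
  move=> a a' /= ma ma'; exists (Order.min a a'); first by rewrite /= lt_min ma.
  by move=> x [Kx] /=; rewrite lt_min => /andP[xa xa']; split.
have FK : F K by exists +oo; [rewrite /= ltey|move=> x []].
have [p [Kp Fp]] := cK F FF FK.
exists p => // y Ky; apply: le_trans (mg y Ky); rewrite leNgt; apply/negP.
move=> /ereal_between[r [mr rp]].
have [V pV Vg] := gl _ _ rp.
have FB : F (B r%:E) by exists r%:E.
have [x [[Kx xr] Vx]] := Fp _ _ FB pV.
by have := lt_trans xr (Vg _ Vx); rewrite ltxx.
Qed.

Lemma lsc_sub_continuous (W : T -> \bar R) (v : T -> R) :
  lower_semicontinuous W -> continuous v ->
  lower_semicontinuous (fun x => W x - (v x)%:E).
Proof.
move=> Wl vc x a.
have E y : (a%:E < W y - (v y)%:E) = ((a + v y)%:E < W y).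
  by rewrite EFinD lteBrDr.
rewrite [_ < _]E => /ereal_between[r []]; rewrite lte_fin -ltrBrDl => ra rW.
have [V xV VW] := Wl _ _ rW.
exists (V `&` [set y | v y < r - a]%R).
  apply: filterI => //.
  have : \forall y \near v x, (y < r - a)%R by exact: lt_nbhsl.
  exact: vc.
move=> y [Vy /= vy]; rewrite [_ < _]E; apply: lt_trans (VW _ Vy).
by rewrite lte_fin -ltrBrDl.
Qed.

End lower_semicontinuity.

(** * Random walk and comparison *)

Section taylor2.
Context {R : realType} {d : nat}.
Implicit Types (x y : 'rV[R]_d) (f g : 'rV[R]_d -> R).

(* A second-order Taylor expansion with [D i] in the role of the [i]-th pure
   second derivative.  First-order and mixed terms do not appear because they
   cancel in the average over the sign flips of the coordinates of [y]. *)
Definition taylor2 f (D : 'I_d -> 'rV[R]_d -> R) (K : R) :=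
  [/\ forall x y r, 0 <= r -> r <= 1 -> (forall i, `|y ord0 i| <= r) ->
        `|symmetrise (fun z => f (x + z)) y - f x
          - 2^-1 * \sum_i D i x * y ord0 i ^+ 2| <= K * r ^+ 3,
      forall x y r, 0 <= r -> (forall i, `|y ord0 i| <= r) ->
        `|\sum_i D i (x + y) - \sum_i D i x| <= K * r,
      measurable_fun setT f, continuous f & exists M, forall x, `|f x| <= M].

Lemma symmetrise_cst a x : symmetrise (fun=> a) x = a.
Proof.
rewrite /symmetrise sumr_const card_ffun card_bool card_ord -[a *+ _]mulr_natl natrX.
by rewrite mulKf// expf_neq0.
Qed.

Lemma symmetriseD f g x :
  symmetrise (fun z => f z + g z) x = symmetrise f x + symmetrise g x.
Proof. by rewrite /symmetrise big_split/= mulrDr. Qed.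

Lemma symmetriseZ a f x : symmetrise (fun z => a * f z) x = a * symmetrise f x.
Proof. by rewrite /symmetrise -mulr_sumr mulrCA. Qed.

Lemma taylor2_zero : taylor2 (fun=> 0) (fun _ _ => 0) 0.
Proof.
split.
- move=> x y r _ _ _; rewrite symmetrise_cst big1 => [|i _]; last by rewrite mul0r.
  by rewrite subrr mulr0 subrr normr0 mul0r.
- by move=> x y r _ _; rewrite big1// subrr normr0 mul0r.
- exact: measurable_cst.
- exact: cst_continuous.
- by exists 0 => x; rewrite normr0.
Qed.

Lemma taylor2_scaleD a f D K g D' K' : taylor2 f D K -> taylor2 g D' K' ->
  taylor2 (fun x => a * f x + g x) (fun i x => a * D i x + D' i x) (`|a| * K + K').
Proof.
move=> [f1 f2 f3 f4 [M f5]] [g1 g2 g3 g4 [M' g5]]; split.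
- move=> x y r r0 r1 yr.
  rewrite (symmetriseD (fun z => a * f (x + z)) (fun z => g (x + z))).
  rewrite (symmetriseZ a (fun z => f (x + z))).
  under eq_bigr do rewrite mulrDl -mulrA.
  rewrite big_split/= -mulr_sumr.
  rewrite (_ : _ - _ = a * (symmetrise (fun z => f (x + z)) y - f x
      - 2^-1 * \sum_i D i x * y ord0 i ^+ 2) +
      (symmetrise (fun z => g (x + z)) y - g x
      - 2^-1 * \sum_i D' i x * y ord0 i ^+ 2)); last by ring.
  rewrite mulrDl (le_trans (ler_normD _ _))// lerD ?g1// normrM -mulrA.
  by rewrite ler_wpM2l// f1.
- move=> x y r r0 yr; rewrite !big_split/= -!mulr_sumr.
  rewrite (_ : _ - _ = a * (\sum_i D i (x + y) - \sum_i D i x) +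
     (\sum_i D' i (x + y) - \sum_i D' i x)); last by ring.
  rewrite mulrDl (le_trans (ler_normD _ _))// lerD ?g2// normrM -mulrA.
  by rewrite ler_wpM2l// f2.
- by apply: measurable_funD => //; apply: measurable_funM => //; exact: measurable_cst.
- by move=> x; exact: (cvgD (cvgM (cvg_cst a) (f4 x)) (g4 x)).
- exists (`|a| * M + M') => x; rewrite (le_trans (ler_normD _ _))// lerD// normrM.
  by rewrite ler_wpM2l.
Qed.

Lemma taylor2_sum (I : Type) (s : seq I) (c : I -> R) (F : I -> 'rV[R]_d -> R)
    (D : I -> 'I_d -> 'rV[R]_d -> R) (K : I -> R) :
  (forall i, taylor2 (F i) (D i) (K i)) ->
  taylor2 (fun x => \sum_(i <- s) c i * F i x)
       (fun j x => \sum_(i <- s) c i * D i j x) (\sum_(i <- s) `|c i| * K i).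
Proof.
move=> nF; elim: s => [|i s IH].
  rewrite big_nil; under eq_fun do rewrite big_nil.
  under [X in taylor2 _ X]eq_fun do under eq_fun do rewrite big_nil.
  exact: taylor2_zero.
rewrite big_cons; under eq_fun do rewrite big_cons.
under [X in taylor2 _ X]eq_fun do under eq_fun do rewrite big_cons.
exact: taylor2_scaleD.
Qed.

Lemma taylor2_translate f D K a : taylor2 f D K ->
  taylor2 (fun x => f (x + a)) (fun i x => D i (x + a)) K.
Proof.
move=> [f1 f2 f3 f4 [M f5]]; split.
- move=> x y r r0 r1 yr; have := f1 (x + a) y r r0 r1 yr.
  by rewrite (_ : (fun z => f (x + z + a)) = (fun z => f (x + a + z)))//;
    apply/funext => z; rewrite addrAC.
- by move=> x y r r0 yr; rewrite addrAC; exact: f2.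
- apply: measurableT_comp => //.
  by under eq_fun do rewrite addrC; exact: measurable_translate.
- move=> x; have xa : (fun z => z + a) @ x --> x + a.
    exact: (cvgD cvg_id (cvg_cst a)).
  exact: (cvg_comp _ _ xa (f4 _)).
- by exists M.
Qed.

Definition unit_step (p : 'I_d * bool) : 'rV[R]_d :=
  (-1) ^+ p.2 *: delta_mx ord0 p.1.

(** The discrete heat operator: one step adds h^2 / (2d) times the Laplacian, up to O(h^3), see
    [walk_expansion]. *)
Definition walk (h : R) f x : R :=
  (2 * d%:R)^-1 * \sum_(p : 'I_d * bool) f (x + h *: unit_step p).

Lemma unit_stepE p i : `|unit_step p ord0 i| = (i == p.1)%:R.
Proof. by rewrite !mxE eqxx normrM normrX normrN1 expr1n mul1r normr_nat. Qed.

Lemma le_walk h f g : (forall x, f x <= g x) -> forall x, walk h f x <= walk h g x.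
Proof.
by move=> fg x; rewrite ler_wpM2l ?invr_ge0 ?mulr_ge0//; apply: ler_sum => p _.
Qed.

(** A step is a convex combination of translates, so [K] stays the same; after any number of steps
    the Taylor constant is still that of [f]. *)
Lemma taylor2_walk h f D K : (0 < d)%N -> taylor2 f D K ->
  taylor2 (walk h f) (fun i => walk h (D i)) K.
Proof.
move=> d0 nf.
have dR : 0 < d%:R :> R by rewrite ltr0n.
have := @taylor2_sum _ (index_enum ('I_d * bool)%type) (fun=> (2 * d%:R)^-1)
  (fun p x => f (x + h *: unit_step p)) (fun p i x => D i (x + h *: unit_step p))
  (fun=> K) (fun p => taylor2_translate (h *: unit_step p) nf).
rewrite /= sumr_const (eq_card (B := predT))// card_prod card_ord card_bool.
rewrite -[_ *+ (d * 2)]mulr_natl natrM ger0_norm ?invr_ge0 ?mulr_ge0//.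
rewrite (_ : _ * (_ * K) = K); last by field; rewrite gt_eqF.
congr taylor2; first by apply/funext => x; rewrite -mulr_sumr.
by apply/funext => i; apply/funext => x; rewrite -mulr_sumr.
Qed.

Lemma flip_unit s i h :
  flip s (h *: unit_step (i, false)) = h *: unit_step (i, s i).
Proof.
apply/rowP => j; rewrite !mxE/=. have [->|ij] := eqVneq j i.
  by rewrite expr0 !mulr1 mulrC.
by rewrite !mulr0.
Qed.

(** Toggling the i-th bit is an involution of the sign vectors, so both values of [s i] occur
    equally often. *)
Lemma sum_bool_coord (F : bool -> R) i :
  \sum_(s : {ffun 'I_d -> bool}) F (s i) = 2 ^+ d * (2^-1 * (F true + F false)).
Proof.
pose t (s : {ffun 'I_d -> bool}) := [ffun j => s j (+) (j == i)].
have tK : involutive t.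
  by move=> s; apply/ffunP => j; rewrite !ffunE -addbA addbb addbF.
have e : \sum_(s : {ffun 'I_d -> bool}) F (s i) =
    \sum_(s : {ffun 'I_d -> bool}) F (~~ s i).
  rewrite (reindex_inj (inv_inj tK)); apply: eq_bigr => s _.
  by rewrite ffunE eqxx addbT.
have : 2 * \sum_(s : {ffun 'I_d -> bool}) F (s i) = 2 ^+ d * (F true + F false).
  rewrite mulr_natl mulr2n {2}e -big_split/=.
  rewrite (eq_bigr (fun=> F true + F false)) => [|s _]; last first.
    by case: (s i); rewrite // addrC.
  rewrite sumr_const card_ffun card_bool card_ord.
  by rewrite -[_ *+ (2 ^ d)]mulr_natl natrX.
by rewrite mulrCA => <-; rewrite mulKf.
Qed.

Lemma symmetrise_unit f i h :
  symmetrise f (h *: unit_step (i, false)) =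
  2^-1 * (f (h *: unit_step (i, true)) + f (h *: unit_step (i, false))).
Proof.
rewrite /symmetrise (eq_bigr (fun s : {ffun 'I_d -> bool} =>
    f (h *: unit_step (i, s i)))) => [|s _]; last by rewrite flip_unit.
by rewrite (sum_bool_coord (fun b => f (h *: unit_step (i, b)))) mulKf// expf_neq0.
Qed.

(** The two neighbours along an axis are sign flips of one vector. The walk thus sees only
    symmetrised values, which are all that [taylor2] controls. *)
Lemma walkE h f x : walk h f x =
  d%:R^-1 * \sum_(i < d) symmetrise (fun z => f (x + z)) (h *: unit_step (i, false)).
Proof.
rewrite /walk (eq_bigr (fun p => f (x + h *: unit_step (p.1, p.2)))) => [|[]//].
rewrite -(pair_bigA _ (fun i b => f (x + h *: unit_step (i, b))))/=.
rewrite invfM -mulrA mulrCA mulr_sumr; congr (_ * _); apply: eq_bigr => i _.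
by rewrite symmetrise_unit big_bool.
Qed.

Lemma coord_unit h i j b : 0 <= h ->
  `|(h *: unit_step (i, b)) ord0 j| = h * (j == i)%:R.
Proof. by move=> h0; rewrite mxE normrM unit_stepE ger0_norm. Qed.

Lemma coord_unit_le h p j : 0 <= h -> `|(h *: unit_step p) ord0 j| <= h.
Proof.
by case: p => i b h0; rewrite coord_unit// ler_piMr// lern1 leq_b1.
Qed.

Lemma walk_expansion h f D K x : (0 < d)%N -> taylor2 f D K -> 0 <= h -> h <= 1 ->
  `|walk h f x - f x - (2 * d%:R)^-1 * h ^+ 2 * \sum_i D i x| <= K * h ^+ 3.
Proof.
move=> d0 [f1 _ _ _ _] h0 h1.
have dR : 0 < d%:R :> R by rewrite ltr0n.
rewrite walkE.
have E : \sum_(i < d) (symmetrise (fun z => f (x + z)) (h *: unit_step (i, false))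
    - f x - 2^-1 * (D i x * h ^+ 2)) =
  \sum_(i < d) symmetrise (fun z => f (x + z)) (h *: unit_step (i, false))
    - d%:R * f x - 2^-1 * (\sum_i D i x * h ^+ 2).
  by rewrite !big_split/= !sumrN sumr_const card_ord mulr_natl mulr_sumr.
have -> : d%:R^-1 * (\sum_(i < d)
    symmetrise (fun z => f (x + z)) (h *: unit_step (i, false))) - f x
    - (2 * d%:R)^-1 * h ^+ 2 * (\sum_i D i x) =
  d%:R^-1 * \sum_(i < d) (symmetrise (fun z => f (x + z)) (h *: unit_step (i, false))
    - f x - 2^-1 * (D i x * h ^+ 2)).
  by rewrite E -mulr_suml; field; rewrite gt_eqF.
rewrite normrM gtr0_norm ?invr_gt0// ler_pdivrMl//.
apply: (le_trans (ler_norm_sum _ _ _)).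
apply: (@le_trans _ _ (\sum_(i < d) K * h ^+ 3)); last first.
  by rewrite sumr_const card_ord mulr_natl.
apply: ler_sum => i _.
have := f1 x (h *: unit_step (i, false)) h h0 h1.
move=> /(_ (fun j => coord_unit_le _ _ h0)).
rewrite (bigD1 i)//= big1 ?addr0 => [|j ji].
  by rewrite !mxE !eqxx/= expr0 !mulr1.
by rewrite !mxE eqxx (negbTE ji) !mulr0 expr0n/= mulr0.
Qed.

Lemma walk_laplacian h f D K x : (0 < d)%N -> taylor2 f D K -> 0 <= h ->
  `|\sum_i walk h (D i) x - \sum_i D i x| <= K * h.
Proof.
move=> d0 [_ f2 _ _ _] h0.
have dR : 0 < d%:R :> R by rewrite ltr0n.
pose c := index_enum ('I_d * bool)%type.
have cE (a : R) : \sum_(p : 'I_d * bool) a = 2 * d%:R * a.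
  by rewrite sumr_const (eq_card (B := predT))// card_prod card_ord card_bool
    -[_ *+ (d * 2)]mulr_natl natrM [d%:R * 2]mulrC.
rewrite -mulr_sumr exchange_big/=.
have -> : (2 * d%:R)^-1 * (\sum_(p : 'I_d * bool) \sum_i D i (x + h *: unit_step p))
    - \sum_i D i x =
  (2 * d%:R)^-1 * \sum_(p : 'I_d * bool)
    (\sum_i D i (x + h *: unit_step p) - \sum_i D i x).
  by rewrite sumrB cE mulrBr mulKf// mulf_neq0// gt_eqF.
rewrite normrM ger0_norm ?invr_ge0 ?mulr_ge0// ler_pdivrMl ?mulr_gt0//.
rewrite -cE; apply: (le_trans (ler_norm_sum _ _ _)); apply: ler_sum => p _.
by apply: f2 => // j; exact: coord_unit_le.
Qed.

Lemma taylor2_iter_walk h f D K n : (0 < d)%N -> taylor2 f D K ->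
  taylor2 (iter n (walk h) f) (fun i => iter n (walk h) (D i)) K.
Proof. by move=> d0 nf; elim: n => // n IH; exact: taylor2_walk. Qed.

(** Finite speed of propagation: it confines the minimisation in [walk_comparison] to a compact
    cube. *)
Lemma iter_walk_support h f L n : 0 <= h ->
  (forall x i, L < `|x ord0 i| -> f x = 0) ->
  forall x i, L + n%:R * h < `|x ord0 i| -> iter n (walk h) f x = 0.
Proof.
move=> h0 fL; elim: n => [|n IH] x i; first by rewrite mul0r addr0; exact: fL.
move=> Lx; rewrite iterS /walk big1 ?mulr0// => p _; apply: (IH _ i).
rewrite [in ltRHS]mxE; have := lerB_normD (x ord0 i) ((h *: unit_step p) ord0 i).
apply: lt_le_trans; rewrite ltrBrDr (le_lt_trans _ Lx)//.
rewrite -nat1r mulrDl mul1r [h + _]addrC addrA lerD2l.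
exact: coord_unit_le.
Qed.

(* Discrete parabolic comparison: at a minimum of [W - walk^n f] the bound on
   the generalised Laplacian of [W] controls the second differences of
   [walk^n f], hence its growth in one step. *)
Lemma walk_comparison (W : 'rV[R]_d -> \bar R) (b C L h : R) f D K :
  (0 < d)%N -> 0 <= C -> 0 <= h -> h <= 1 -> 0 <= K ->
  lower_semicontinuous W -> locally_integrable_rV W ->
  (forall x, b%:E <= W x)%E -> (forall x, laplacian0 W x <= C%:E)%E ->
  taylor2 f D K -> (forall x i, L < `|x ord0 i| -> f x = 0) ->
  (forall x, (b + f x)%:E <= W x)%E ->
  forall n x, ((b + iter n (walk h) f x)%:E <= W x
    + (n%:R * (h ^+ 2 * (8 * d%:R ^+ 3 * C) + 2 * K * h ^+ 3))%:E)%E.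
Proof.
move=> d0 C0 h0 h1 K0 Wl Wloc Wb WC nf fL fW.
have dR : 0 < d%:R :> R by rewrite ltr0n.
set C1 := 8 * d%:R ^+ 3 * C; set a := _ + 2 * K * h ^+ 3.
have C10 : 0 <= C1 by rewrite !mulr_ge0// exprn_ge0// ltW.
have a0 : 0 <= a by rewrite addr_ge0// !mulr_ge0// ?exprn_ge0.
elim=> [|n IH] x; first by rewrite mul0r adde0.
set v := iter n.+1 (walk h) f.
rewrite leNgt; apply/negP => vx.
(* Outside the cube of half-side [L'], [v] vanishes and [W - v] is at least [b]; since [W - v] is
   below [b] at [x], its minimum over the cube is global. *)
pose L' := L + n.+1%:R * h.
have vL y i : L' < `|y ord0 i| -> v y = 0 by exact: iter_walk_support.
have nv := taylor2_iter_walk h n.+1 d0 nf; rewrite -/v in nv.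
have [v1 _ v3 v4 [M v5]] := nv.
have Wxfin : W x \is a fin_num.
  rewrite fin_numE -ltNye (lt_le_trans (ltNyr b))//=.
  by apply/eqP => Woo; move: vx; rewrite Woo addye// ltNge leey.
have na0 : 0 <= n.+1%:R * a by rewrite mulr_ge0.
have Wvx : (W x - (v x)%:E < (b - n.+1%:R * a)%:E)%E.
  move: vx; rewrite -(fineK Wxfin) -EFinD -EFinB !lte_fin; lra.
pose B := [set y : 'rV[R]_d | forall i, `|y ord0 i| <= L'].
have outB y : ~ B y -> v y = 0.
  move=> /existsNP[i /negP]; rewrite -ltNge; exact: vL.
have Bx : B x.
  apply/not_notP => /outB vx0; move: Wvx; rewrite vx0 sube0 ltNge.
  apply/negP; rewrite negbK; apply: le_trans (Wb x).
  by rewrite lee_fin gerDl oppr_le0.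
have [x0 Bx0 minx0] := lsc_compact_min (lsc_sub_continuous Wl v4) (@coord_compact _ _ L')
  (ex_intro _ x Bx).
have min0 : (W x0 - (v x0)%:E < (b - n.+1%:R * a)%:E)%E.
  by apply: le_lt_trans Wvx; exact: minx0.
have [w Ww] : exists w, W x0 = w%:E.
  have := Wb x0; move: min0; case: (W x0) => [w _ _|//|//].
  by exists w.
have globmin y : ((w + (v (x0 + y) - v x0))%:E <= W (x0 + y)%R)%E.
  have [By|/outB vy0] := pselect (B (x0 + y)).
    have := minx0 _ By; rewrite Ww leeBrDr// -EFinB -EFinD.
    by rewrite (_ : w - v x0 + v (x0 + y) = w + (v (x0 + y) - v x0))//; ring.
  apply: le_trans (Wb _); rewrite vy0 sub0r lee_fin.
  by move: min0; rewrite Ww -EFinB lte_fin; lra.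
(* Only a positive sum matters; the minimum in [laplacian0_touch] is then the sum divided by 8 d^3,
   and the factor d + 2 is bounded below by 1. *)
have sC : \sum_i iter n.+1 (walk h) (D i) x0 <= C1.
  have [s0|s0] := leP (\sum_i iter n.+1 (walk h) (D i) x0) 0; first exact: le_trans C10.
  have := @laplacian0_touch R d W x0 w (fun y => v (x0 + y) - v x0)
    (fun i => iter n.+1 (walk h) (D i) x0) K 1 d0 ltr01 Wloc Ww.
  have bb : ball_bounded 1 (fun y => v (x0 + y) - v x0).
    split.
      apply: measurable_funB => //.
      by apply: measurableT_comp => //; exact: measurable_translate.
    exists (M + M) => y _; rewrite (le_trans (ler_normB _ _))// lerD//.
  move=> /(_ bb (fun y _ => globmin y)) touch.
  have {}touch : ((d%:R + 2) * Num.min ((\sum_i iter n.+1 (walk h) (D i) x0) /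
      (8 * d%:R ^+ 3)) (\sum_i iter n.+1 (walk h) (D i) x0) <= C).
    rewrite -lee_fin; apply: le_trans (WC x0); apply: touch => y r r0 r1 yr.
    rewrite (symmetriseD (fun y => v (x0 + y)) (fun=> - v x0)) symmetrise_cst.
    have := v1 x0 y r r0 r1 yr; rewrite ler_norml => /andP[+ _].
    by rewrite lerBrDr addrC.
  have d3 : 1 <= 8 * d%:R ^+ 3 :> R.
    by rewrite mulr_ege1// ?ler1n// exprn_ege1// ler1n.
  have p3 : 0 < 8 * d%:R ^+ 3 :> R by exact: lt_le_trans d3.
  rewrite -ler_pdivrMl// mulrC; apply: le_trans touch.
  rewrite min_l; last by rewrite ler_pdivrMr// ler_peMr// ltW.
  rewrite ler_peMl//; first by rewrite divr_ge0// ltW.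
  by rewrite -[leLHS]add0r lerD// ?ler1n// ltW.
(* The Laplacian is bounded at time n + 1, whereas the increment is expanded at time n. The two
   Laplacians differ by at most K h, which accounts for the second K h^3 in [a]. *)
have nvn := taylor2_iter_walk h n d0 nf.
set s := \sum_i iter n (walk h) (D i) x0.
have e1 : `|v x0 - iter n (walk h) f x0 - (2 * d%:R)^-1 * h ^+ 2 * s| <= K * h ^+ 3.
  exact: walk_expansion nvn h0 h1.
have e2 : `|\sum_i iter n.+1 (walk h) (D i) x0 - s| <= K * h.
  exact: walk_laplacian nvn h0.
move: e1 e2; rewrite !ler_norml => /andP[_ e1] /andP[e2 _].
have IHx := IH x0; rewrite Ww -EFinD lee_fin in IHx.
move: min0; rewrite Ww -EFinB lte_fin; apply/negP; rewrite -leNgt.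
have sC1 : s <= C1 + K * h by lra.
have hh : (2 * d%:R)^-1 * h ^+ 2 * s <= h ^+ 2 * C1 + K * h ^+ 3.
  apply: (@le_trans _ _ ((2 * d%:R)^-1 * h ^+ 2 * (C1 + K * h))).
    by rewrite ler_wpM2l// mulr_ge0 ?sqr_ge0// invr_ge0 mulr_ge0// ltW.
  rewrite (_ : h ^+ 2 * C1 + K * h ^+ 3 = 1 * (h ^+ 2 * (C1 + K * h))); last by ring.
  rewrite -mulrA ler_wpM2r//.
    by rewrite mulr_ge0 ?sqr_ge0// addr_ge0// mulr_ge0.
  rewrite invf_le1 ?mulr_gt0//.
  by rewrite mulr_ege1// ler1n.
rewrite -nat1r mulrDl mul1r /a; rewrite /a in IHx; lra.
Qed.

End taylor2.

(** * Repulsive potentials are infinite at the origin *)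

Section origin.
Context {R : realType} {d : nat}.
Implicit Types (x y : 'rV[R]_d) (W : 'rV[R]_d -> \bar R).

Lemma continuous_sum_fun (T : topologicalType) (I : Type) (s : seq I) (F : I -> T -> R) :
  (forall i, continuous (F i)) -> continuous (fun t => \sum_(i <- s) F i t).
Proof.
move=> cF; elim: s => [|i s IH] t.
  under eq_fun do rewrite big_nil; exact: cvg_cst.
under eq_fun do rewrite big_cons.
exact: (cvgD (cF i t) (IH t)).
Qed.

Lemma continuous_prod_fun (T : topologicalType) (I : Type) (s : seq I) (F : I -> T -> R) :
  (forall i, continuous (F i)) -> continuous (fun t => \prod_(i <- s) F i t).
Proof.
move=> cF; elim: s => [|i s IH] t.
  under eq_fun do rewrite big_nil; exact: cvg_cst.
under eq_fun do rewrite big_cons.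
exact: (cvgM (cF i t) (IH t)).
Qed.

Lemma continuous_coord i : continuous (fun x : 'rV[R]_d => x ord0 i).
Proof. exact: coord_continuous. Qed.

Lemma symmetrise_sum (I : Type) (s : seq I) (F : I -> 'rV[R]_d -> R) x :
  symmetrise (fun z => \sum_(i <- s) F i z) x = \sum_(i <- s) symmetrise (F i) x.
Proof. by rewrite /symmetrise exchange_big/= mulr_sumr. Qed.

Lemma symmetrise_coord i x : symmetrise (fun z => z ord0 i) x = 0.
Proof.
rewrite /symmetrise.
rewrite (eq_bigr (fun s : {ffun 'I_d -> bool} => (-1) ^+ s i * x ord0 i)).
  rewrite (sum_bool_coord (fun b : bool => (-1) ^+ b * x ord0 i)).
  by rewrite expr1 expr0 mulN1r mul1r addNr !mulr0.
by move=> s _; rewrite mxE.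
Qed.

Lemma symmetrise_coord2 i x : symmetrise (fun z => z ord0 i ^+ 2) x = x ord0 i ^+ 2.
Proof.
rewrite -[RHS](symmetrise_cst _ (0 : 'rV[R]_d)) /symmetrise; congr (_ * _).
by apply: eq_bigr => s _; rewrite mxE exprMn sqrr_sign mul1r.
Qed.

Lemma ln_tangent (s t : R) : 0 < s -> 0 < t -> ln t <= ln s + (t - s) / s.
Proof.
move=> s0 t0; rewrite -lerBlDl -ln_div ?posrE//.
have ts : 0 < t / s by rewrite divr_gt0.
have e : t / s = 1 + (t - s) / s by field; rewrite gt_eqF.
by rewrite {1}e; apply: le_ln1Dx; rewrite -subr_gt0 opprK addrC -e.
Qed.

Lemma small_powR (p c r : R) : 0 < p -> 0 < c -> 0 < r ->
  exists2 t, 0 < t < r & t `^ p < c.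
Proof.
move=> p0 c0 r0.
have [t [t0 tr tc]] : exists t, [/\ 0 < t, t < r & t <= (c / 2) `^ p^-1].
  exists (Num.min (r / 2) ((c / 2) `^ p^-1)); split.
  - by rewrite lt_min divr_gt0// powR_gt0// divr_gt0.
  - by rewrite gt_min; apply/orP; left; rewrite ltr_pdivrMr// ltr_pMr// ltr1n.
  - by rewrite ge_min lexx orbT.
exists t; first by rewrite t0.
apply: (@le_lt_trans _ _ (c / 2)); last by rewrite ltr_pdivrMr// ltr_pMr// ltr1n.
have -> : c / 2 = ((c / 2) `^ p^-1) `^ p.
  by rewrite -powRrM mulVf ?gt_eqF// powRr1// divr_ge0// ltW.
by apply: ge0_ler_powR => //; rewrite ?nnegrE ?powR_ge0// ltW.
Qed.

(* The barrier [- ln (|x|^2 + l) / 2] is touched from below at every point by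
   a paraboloid of Laplacian [- d / (|x|^2 + l)], which is too large for a
   [beta]-repulsive [W] when [beta > 2]; letting [l] tend to 0 gives the claim. *)
Lemma repulsive_origin W (b beta : R) : (0 < d)%N -> 2 < beta ->
  lower_semicontinuous W -> (forall x, b%:E <= W x)%E -> repulsive beta W ->
  W 0 = +oo%E.
Proof.
move=> d0 beta2 Wl Wb [Wloc [delta [C [delta0 C0 WC W0]]]].
have dR : 0 < d%:R :> R by rewrite ltr0n.
have d2 : 0 < (d%:R + 2) * d%:R :> R by rewrite mulr_gt0// ltr_wpDl.
have [//|Wfin] := eqVneq (W 0) +oo%E; exfalso.
have [w0 Ww0] : exists w, W 0 = w%:E.
  by have := Wb 0; move: Wfin; case: (W 0) => [w|//|//] _ _; exists w.
(* Within radius [r], the bound (d+2) d |x|^(-2) that touching will give stays below C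
   |x|^(-beta). *)
have [r /andP[r0 rdelta] rC] := @small_powR (beta - 2) (C / ((d%:R + 2) * d%:R)) delta
  (ltac:(by rewrite subr_gt0)) (divr_gt0 C0 d2) delta0.
pose rho := r / d%:R.
have rho0 : 0 < rho by rewrite divr_gt0.
(* This makes [phi 0] exceed by 1 the sum of w0 - b and of the bound - ln(rho^2) / 2 for [phi] on
   the faces of the cube, so the minimum of [W - phi] is not attained on a face. *)
pose l := expR (- 2 * (w0 - b - 2^-1 * ln (rho ^+ 2) + 1)).
have l0 : 0 < l by exact: expR_gt0.
pose n2 (x : 'rV[R]_d) : R := \sum_i x ord0 i ^+ 2.
have n20 x : 0 <= n2 x by rewrite sumr_ge0// => i _; exact: sqr_ge0.
pose phi x := - (2^-1 * ln (n2 x + l)).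
have n2l x : 0 < n2 x + l by rewrite ltr_wpDl.
have n2c0 : continuous n2.
  apply: continuous_sum_fun => i z.
  exact: (cvgM (@continuous_coord i z) (@continuous_coord i z)).
have n2c : continuous (fun x => n2 x + l).
  by move=> x; exact: (cvgD (n2c0 x) (cvg_cst _)).
have phic : continuous phi.
  move=> x; have lnc : (fun z => ln (n2 z + l)) @ x --> ln (n2 x + l).
    exact: (cvg_comp _ _ (n2c x) (continuous_ln (n2l x))).
  exact: (cvgN (cvgM (cvg_cst (2^-1 : R)) lnc)).
have K0 : [set y : 'rV[R]_d | forall i, `|y ord0 i| <= rho] !=set0.
  by exists 0 => i; rewrite mxE normr0 ltW.
have [x0 Kx0 minx0] := lsc_compact_min (lsc_sub_continuous Wl phic)
  (@coord_compact _ _ rho) K0.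
have min0 : (W x0 - (phi x0)%:E <= (w0 - phi 0)%:E)%E.
  by rewrite EFinB -Ww0; apply: minx0 => i; rewrite mxE normr0 ltW.
have [w Ww] : exists w, W x0 = w%:E.
  by have := Wb x0; move: min0; case: (W x0) => [w _ _|//|//]; exists w.
have phi0 : phi 0 = w0 - b - 2^-1 * ln (rho ^+ 2) + 1.
  rewrite /phi /n2 big1 => [|i _]; last by rewrite mxE expr0n.
  by rewrite add0r expRK; field.
have Kint i : `|x0 ord0 i| < rho.
  rewrite lt_neqAle Kx0 andbT; apply/eqP => x0i.
  have : phi x0 <= - (2^-1 * ln (rho ^+ 2)).
    rewrite lerN2 ler_wpM2l// ler_ln ?posrE ?exprn_gt0//.
    rewrite -x0i real_normK ?num_real// -[leLHS]addr0 lerD ?(ltW l0)//.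
    by rewrite /n2 (bigD1 i)//= lerDl sumr_ge0// => j _; exact: sqr_ge0.
  move: min0; rewrite phi0 Ww -EFinB lee_fin.
  have := Wb x0; rewrite Ww lee_fin; lra.
have [r1 r10 r1K] : exists2 r1, 0 < r1 & forall y, eball r1 y ->
    forall i, `|(x0 + y) ord0 i| <= rho.
  exists (\big[Num.min/1]_i (rho - `|x0 ord0 i|)).
    by apply/bigmin_gtP; split=> // i _; rewrite subr_gt0.
  move=> y yr i; rewrite mxE (le_trans (ler_normD _ _))// -lerBrDl.
  apply: le_trans (ler_coord_enorm _ _) _; apply: le_trans (ltW yr) _.
  exact: bigmin_le_cond.
set a := n2 x0 + l.
have a0 : 0 < a by exact: n2l.
(* The tangent of the concave logarithm at [a], evaluated at |x0 + y|^2 + l. Symmetrised, it is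
   exactly quadratic, hence the error constant 0 below. *)
pose q y := \sum_i (- (x0 ord0 i / a) * y ord0 i + (- (2 * a)^-1) * y ord0 i ^+ 2).
have qphi y : q y <= phi (x0 + y) - phi x0.
  have t := ln_tangent a0 (n2l (x0 + y)).
  have e : n2 (x0 + y) = n2 x0 + \sum_i (2 * x0 ord0 i * y ord0 i + y ord0 i ^+ 2).
    rewrite /n2 -big_split/=; apply: eq_bigr => i _; rewrite mxE; ring.
  have qe : q y = - (2^-1 * ((n2 (x0 + y) + l - a) / a)).
    rewrite e /a (_ : _ - _ = \sum_i (2 * x0 ord0 i * y ord0 i + y ord0 i ^+ 2));
      last by ring.
    rewrite mulr_suml mulr_sumr -sumrN; apply: eq_bigr => i _; rewrite -/a.
    by field; rewrite gt_eqF.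
  rewrite qe /phi -/a; lra.
have bq : ball_bounded r1 q.
  apply: ball_bounded_sum => i; apply: ball_boundedD; apply: ball_boundedM.
  - exact: ball_bounded_cst.
  - exact: ball_bounded_coord.
  - exact: ball_bounded_cst.
  - exact: ball_bounded_coord2.
have qW y : eball r1 y -> ((w + q y)%:E <= W (x0 + y)%R)%E.
  move=> /r1K /minx0; rewrite Ww leeBrDr// => h; apply: le_trans h.
  rewrite -[leRHS]/((w - phi x0 + phi (x0 + y))%:E) lee_fin.
  by have := qphi y; lra.
have := @laplacian0_touch _ _ W x0 w q (fun=> - a^-1) 0 r1 d0 r10 Wloc Ww bq qW.
have sq y r2 : 0 <= r2 -> r2 <= 1 -> (forall i, `|y ord0 i| <= r2) ->
    2^-1 * (\sum_i - a^-1 * y ord0 i ^+ 2) - 0 * r2 ^+ 3 <= symmetrise q y.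
  move=> _ _ _; rewrite mul0r subr0 symmetrise_sum mulr_sumr le_eqVlt.
  apply/orP; left; apply/eqP; apply: eq_bigr => i _.
  rewrite (symmetriseD (fun y => - (x0 ord0 i / a) * y ord0 i)
    (fun y => - (2 * a)^-1 * y ord0 i ^+ 2)).
  rewrite (symmetriseZ _ (fun y => y ord0 i)) (symmetriseZ _ (fun y => y ord0 i ^+ 2)).
  rewrite symmetrise_coord symmetrise_coord2 invfM; ring.
move=> /(_ sq); rewrite sumr_const card_ord.
set s := - a^-1 *+ d.
have sE : s = - (d%:R / a) by rewrite /s ?mulNrn -[a^-1 *+ d]mulr_natl.
have d3 : 1 <= 8 * d%:R ^+ 3 :> R.
  by rewrite mulr_ege1// ?ler1n// exprn_ege1// ler1n.
have s0 : s <= 0 by rewrite sE oppr_le0 divr_ge0 ?ltW.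
rewrite min_r; last first.
  rewrite ler_pdivlMr; last exact: lt_le_trans d3.
  by rewrite -[leRHS]mulr1 ler_wnM2l.
move=> touch.
(* At the origin the finite lower bound contradicts an infinite Laplacian; elsewhere it contradicts
   the choice of [r]. *)
have [x00|x00] := eqVneq x0 0.
  by move: touch W0; rewrite x00; case: (laplacian0 W 0).
have ex0 : 0 < enorm x0.
  rewrite lt_neqAle enorm_ge0 andbT eq_sym; apply: contra x00.
  rewrite -sqrf_eq0 enorm_sqr psumr_eq0 => [|i _]; last exact: sqr_ge0.
  move=> /allP x00; apply/eqP/rowP => i; rewrite mxE.
  by have := x00 i (mem_index_enum i); rewrite sqrf_eq0 => /eqP.
have ex0r : enorm x0 < r.
  rewrite enorm_lt//; apply: (@lt_le_trans _ _ (\sum_(i < d) rho ^+ 2)).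
    apply: ltr_sum => [|i _].
      by apply/hasP; exists (Ordinal d0) => //; rewrite mem_index_enum.
    rewrite -(@real_normK _ (x0 ord0 i)) ?num_real//.
    by rewrite ltr_pXn2r// ?nnegrE// ltW.
  rewrite sumr_const card_ord -[leLHS]mulr_natr expr_div_n -mulrA ler_piMr ?sqr_ge0//.
  rewrite expr2 invfM -mulrA mulVf ?gt_eqF// mulr1 invf_le1//.
  by rewrite ler1n.
have := WC x0; rewrite ex0 (lt_trans ex0r rdelta) => /(_ isT).
rewrite leeNr => /(le_trans touch); rewrite -EFinN lee_fin sE mulrN lerN2.
apply/negP; rewrite -ltNge mulrA.
have n2x0 : n2 x0 = enorm x0 ^+ 2 by rewrite enorm_sqr.
apply: (@le_lt_trans _ _ ((d%:R + 2) * d%:R / enorm x0 ^+ 2)).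
  rewrite ler_wpM2l ?(ltW d2)// lef_pV2 ?posrE ?exprn_gt0//.
  by rewrite /a n2x0 lerDl ltW.
rewrite ltr_pdivrMr ?exprn_gt0// -mulrA -powR_mulrn ?enorm_ge0// -powRD; last first.
  by apply/implyP => _; rewrite gt_eqF.
rewrite (_ : - beta + 2%:R = - (beta - 2)); last by ring.
rewrite powRN ltr_pdivlMr ?powR_gt0// mulrC -ltr_pdivlMr//.
apply: le_lt_trans rC; apply: ge0_ler_powR; rewrite ?nnegrE ?subr_ge0 ?ltW//.
Qed.

End origin.

(** * Spline approximation *)

Section spline.
Context {R : realType}.
Implicit Types t u x y : R.

Definition pos_cube t : R := Num.max t 0 ^+ 3.

(** The distribution function of a sum of three independent uniform variables on [0, 1]. Its unit
    increments are the cubic B-spline [spline], so sums of integer translates telescope. *)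
Definition cdf_spline t : R :=
  6^-1 * (pos_cube t - 3 * pos_cube (t - 1) + 3 * pos_cube (t - 2) - pos_cube (t - 3)).

Definition spline t : R := 6^-1 * (pos_cube t - 4 * pos_cube (t - 1)
  + 6 * pos_cube (t - 2) - 4 * pos_cube (t - 3) + pos_cube (t - 4)).

Definition spline'' t : R := Num.max t 0 - 4 * Num.max (t - 1) 0
  + 6 * Num.max (t - 2) 0 - 4 * Num.max (t - 3) 0 + Num.max (t - 4) 0.

Lemma spline_telescope t : spline t = cdf_spline t - cdf_spline (t - 1).
Proof.
rewrite /cdf_spline /spline -!addrA -!opprD.
have -> : 1 + 1 = 2 :> R by ring.
have -> : 1 + 2 = 3 :> R by ring.
have -> : 1 + 3 = 4 :> R by ring.
ring.
Qed.

Lemma pos_cube_le0 t : t <= 0 -> pos_cube t = 0.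
Proof. by move=> t0; rewrite /pos_cube max_r// expr0n. Qed.

Lemma pos_cube_ge0 t : 0 <= t -> pos_cube t = t ^+ 3.
Proof. by move=> t0; rewrite /pos_cube max_l. Qed.

Lemma cdf_spline_le0 t : t <= 0 -> cdf_spline t = 0.
Proof. by move=> t0; rewrite /cdf_spline !pos_cube_le0; lra. Qed.

Lemma cdf_spline_ge3 t : 3 <= t -> cdf_spline t = 1.
Proof. by move=> t3; rewrite /cdf_spline !pos_cube_ge0; [field|lra..]. Qed.

Lemma spline_eq0 t : ~~ (0 < t < 4) -> spline t = 0.
Proof.
rewrite spline_telescope negb_and -!leNgt => /orP[t0|t4].
  by rewrite !cdf_spline_le0; lra.
by rewrite !cdf_spline_ge3; lra.
Qed.

Lemma spline_ge0 t : 0 <= spline t.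
Proof.
have [t04|/spline_eq0 ->//] := boolP (0 < t < 4).
rewrite /spline.
have [t1|t1] := leP t 1.
  rewrite (@pos_cube_ge0 t) ?(@pos_cube_le0 (t - _)); [nra|lra..].
have [t2|t2] := leP t 2.
  rewrite (@pos_cube_ge0 t) ?(@pos_cube_ge0 (t - 1)) ?(@pos_cube_le0 (t - _)); [|lra..].
  by have : 0 <= (t - 1) * (2 - t); nra.
have [t3|t3] := leP t 3.
  rewrite (@pos_cube_ge0 t) ?(@pos_cube_ge0 (t - 1)) ?(@pos_cube_ge0 (t - 2))
    ?(@pos_cube_le0 (t - _)); [|lra..].
  by have : 0 <= (t - 2) * (3 - t); nra.
rewrite (@pos_cube_le0 (t - 4)) ?(@pos_cube_ge0 t) ?(@pos_cube_ge0 (t - _)); [|lra..].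
rewrite (_ : _ * _ = 6^-1 * (4 - t) ^+ 3); last by congr (_ * _); ring.
by rewrite mulr_ge0// exprn_ge0//; lra.
Qed.

Lemma sum_spline m t : \sum_(k < m) spline (t - k%:R) = cdf_spline t - cdf_spline (t - m%:R).
Proof.
elim: m => [|m IH]; first by rewrite big_ord0 subr0 subrr.
have -> : t - m.+1%:R = t - m%:R - 1 by rewrite -natr1; ring.
rewrite big_ord_recr/= IH spline_telescope; ring.
Qed.

(** Telescoping down to a nonpositive argument, where the function vanishes, writes the value as a
    sum of nonnegative spline values. *)
Lemma cdf_spline_ge0 t : 0 <= cdf_spline t.
Proof.
have := sum_spline (Num.truncn `|t|).+1 t.
rewrite (@cdf_spline_le0 (t - _)) ?subr0 => [<-|].
  by rewrite sumr_ge0// => i _; exact: spline_ge0.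
by rewrite subr_le0 (le_trans (ler_norm t))// ltW// truncnS_gt.
Qed.

Lemma cdf_spline_le1 t : cdf_spline t <= 1.
Proof.
have := sum_spline (Num.truncn `|3 - t|).+1 (t + (Num.truncn `|3 - t|).+1%:R).
rewrite addrK (@cdf_spline_ge3 (t + _)); last first.
  by rewrite -lerBlDl (le_trans (ler_norm _))// ltW// truncnS_gt.
by move=> e; rewrite -subr_ge0 -e sumr_ge0// => i _; exact: spline_ge0.
Qed.

(** The expansion is exact unless the kink at 0 lies between x - y and x + y; in that case |x| is at
    most |y| and every term is O(|y|^3). *)
Lemma pos_cube_expansion x y :
  `|2^-1 * (pos_cube (x + y) + pos_cube (x - y)) - pos_cube x
    - 2^-1 * (6 * Num.max x 0) * y ^+ 2| <= 12 * `|y| ^+ 3.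
Proof.
wlog y0 : y / 0 <= y => [h|].
  have [/h//|y0] := leP 0 y.
  by have := h (- y); rewrite opprK sqrrN normrN [pos_cube _ + _]addrC; apply; lra.
rewrite (ger0_norm y0).
have [xy|xy] := leP y x.
  rewrite !pos_cube_ge0; [|lra..]; rewrite max_l; last lra.
  rewrite (_ : `|_| = 0); first by rewrite mulr_ge0// exprn_ge0.
  by apply/eqP; rewrite normr_eq0; apply/eqP; field.
have [yx|yx] := leP x (- y).
  rewrite !pos_cube_le0; [|lra..]; rewrite max_r; last lra.
  rewrite (_ : `|_| = 0); first by rewrite mulr_ge0// exprn_ge0.
  by apply/eqP; rewrite normr_eq0; apply/eqP; ring.
rewrite (@pos_cube_ge0 (x + y)) ?(@pos_cube_le0 (x - y)); [|lra..].
have [x0|x0] := leP 0 x.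
  rewrite pos_cube_ge0//.
  have h1 : 0 <= (x + y) ^+ 3 <= 8 * y ^+ 3.
    rewrite exprn_ge0 ?addr_ge0//=; have -> : 8 * y ^+ 3 = (2 * y) ^+ 3 by ring.
    by rewrite lerXn2r ?nnegrE; lra.
  have h2 : 0 <= x ^+ 3 <= y ^+ 3.
    by rewrite exprn_ge0//= lerXn2r ?nnegrE; lra.
  have h3 : 0 <= x * y ^+ 2 <= y ^+ 3.
    by rewrite mulr_ge0 ?sqr_ge0//= [y ^+ 3]exprS ler_wpM2r ?sqr_ge0// ltW.
  rewrite -mulrA -mulrA ler_norml; lra.
rewrite (pos_cube_le0 (ltW x0)).
have h1 : 0 <= (x + y) ^+ 3 <= 8 * y ^+ 3.
  rewrite exprn_ge0/=; last lra.
  have -> : 8 * y ^+ 3 = (2 * y) ^+ 3 by ring.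
  by rewrite lerXn2r ?nnegrE; lra.
rewrite ler_norml; lra.
Qed.

(** The absolute coefficients 1, 4, 6, 4, 1 add up to 16, and 32 = 12 * 16 / 6; the Lipschitz
    constants 16 and 128 = 48 * 16 / 6 below arise in the same way. *)
Lemma spline_expansion x y :
  `|2^-1 * (spline (x + y) + spline (x - y)) - spline x
    - 2^-1 * spline'' x * y ^+ 2| <= 32 * `|y| ^+ 3.
Proof.
have e c : pos_cube (x + y - c) = pos_cube (x - c + y) by rewrite addrAC.
have e' c : pos_cube (x - y - c) = pos_cube (x - c - y) by rewrite addrAC.
rewrite /spline /spline'' !e !e'.
have := pos_cube_expansion x y; have := pos_cube_expansion (x - 1) y.
have := pos_cube_expansion (x - 2) y; have := pos_cube_expansion (x - 3) y.
have := pos_cube_expansion (x - 4) y.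
set Y := `|y| ^+ 3; rewrite !ler_norml.
have E (a : R) : 2^-1 * (6 * a) * y ^+ 2 = 3 * (a * y ^+ 2) by field.
rewrite !E.
set y2 := y ^+ 2.
move: (Num.max x 0) (Num.max (x - 1) 0) (Num.max (x - 2) 0) => m0 m1 m2.
move: (Num.max (x - 3) 0) (Num.max (x - 4) 0) => m3 m4.
have -> : 2^-1 * (m0 - 4 * m1 + 6 * m2 - 4 * m3 + m4) * y2 = 2^-1 * (m0 * y2
    - 4 * (m1 * y2) + 6 * (m2 * y2) - 4 * (m3 * y2) + m4 * y2) by ring.
move: (m0 * y2) (m1 * y2) (m2 * y2) (m3 * y2) (m4 * y2) => n0 n1 n2 n3 n4 *; lra.
Qed.

Lemma maxr0_lipschitz x y : `|Num.max x 0 - Num.max y 0| <= `|x - y|.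
Proof.
by case: (leP x 0); case: (leP y 0) => ? ?; rewrite ler_norml;
  case: (ger0P (x - y)); lra.
Qed.

Lemma spline''_lipschitz x y : `|spline'' x - spline'' y| <= 16 * `|x - y|.
Proof.
have e c : `|Num.max (x - c) 0 - Num.max (y - c) 0| <= `|x - y|.
  apply: (le_trans (maxr0_lipschitz _ _)).
  by rewrite (_ : x - c - (y - c) = x - y)//; ring.
have := maxr0_lipschitz x y; have := e 1; have := e 2; have := e 3; have := e 4.
rewrite /spline'' !ler_norml; lra.
Qed.

Lemma spline''_eq0 t : ~~ (0 < t < 4) -> spline'' t = 0.
Proof.
rewrite negb_and -!leNgt => /orP[t0|t4]; rewrite /spline''.
  by rewrite !max_r; lra.
by rewrite !max_l; lra.
Qed.

Lemma spline''_bounded t : `|spline'' t| <= 64.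
Proof.
have [t04|/spline''_eq0 ->] := boolP (0 < t < 4); last by rewrite normr0 ler0n.
have := spline''_lipschitz t 0; rewrite (@spline''_eq0 0) ?ltxx// !subr0.
by rewrite (@gtr0_norm _ t); lra.
Qed.

(** On arguments up to 4 the slope is at most 3 * 4^2 = 48; [spline_clip] reduces the spline to such
    arguments. *)
Lemma pos_cube_lipschitz x y : x <= 4 -> y <= 4 ->
  `|pos_cube x - pos_cube y| <= 48 * `|x - y|.
Proof.
move=> x4 y4; rewrite /pos_cube subrXX normrM mulrC.
apply: ler_pM => //; last exact: maxr0_lipschitz.
rewrite !big_ord_recr big_ord0/= add0r !subSS.
have : 0 <= Num.max x 0 <= 4 by rewrite le_max lexx orbT ge_max x4/=.
have : 0 <= Num.max y 0 <= 4 by rewrite le_max lexx orbT ge_max y4/=.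
move: (Num.max x 0) (Num.max y 0) => a b b4 a4.
rewrite ger0_norm; last by nra.
by nra.
Qed.

Lemma spline_clip t : spline t = spline (Num.min (Num.max t 0) 4).
Proof.
have spline0 : spline (0 : R) = 0 by apply: spline_eq0; rewrite ltxx.
have spline4 : spline (4 : R) = 0 by apply: spline_eq0; rewrite ltxx andbF.
have [t0|t0] := leP t 0.
  by rewrite min_l// spline0 spline_eq0// negb_and -leNgt t0.
have [t4|t4] := leP t 4; first by [].
by rewrite spline4 spline_eq0// negb_and -!leNgt (ltW t4) orbT.
Qed.

Lemma spline_lipschitz x y : `|spline x - spline y| <= 128 * `|x - y|.
Proof.
rewrite (spline_clip x) (spline_clip y).
have clip : `|Num.min (Num.max x 0) 4 - Num.min (Num.max y 0) 4| <= `|x - y|.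
  apply: le_trans (maxr0_lipschitz x y).
  move: (Num.max x 0) (Num.max y 0) => a b.
  by case: (leP a 4); case: (leP b 4) => ? ?; rewrite ler_norml;
    case: (ger0P (a - b)); lra.
suff h : forall a b : R, a <= 4 -> b <= 4 -> `|spline a - spline b| <= 128 * `|a - b|.
  apply: le_trans (h _ _ _ _) _; rewrite ?ge_min ?lexx ?orbT//.
  by rewrite ler_wpM2l.
move=> a b a4 b4.
have e c : 0 <= c -> `|pos_cube (a - c) - pos_cube (b - c)| <= 48 * `|a - b|.
  move=> c0; have := @pos_cube_lipschitz (a - c) (b - c).
  by rewrite (_ : a - c - (b - c) = a - b); [apply; lra|ring].
have := pos_cube_lipschitz a4 b4.
have := e 1 ler01; have := e 2 (ltac:(lra)); have := e 3 (ltac:(lra)).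
have := e 4 (ltac:(lra)).
rewrite /spline !ler_norml; lra.
Qed.

Lemma spline_bounded t : `|spline t| <= 512.
Proof.
have [t04|/spline_eq0 ->] := boolP (0 < t < 4); last by rewrite normr0 ler0n.
have := spline_lipschitz t 0; rewrite (@spline_eq0 0) ?ltxx// !subr0.
by rewrite (@gtr0_norm _ t); lra.
Qed.

End spline.

(** * Expansions and Lipschitz bounds of finite products *)

Section products.
Context {R : realType}.

(** The base K + 3 B is generous here so that this bound and the next two share a single
    constant. *)
Lemma prod_bounded (I : Type) (s : seq I) (B K : R) (u : I -> R) : 1 <= B -> 0 <= K ->
  (forall i, `|u i| <= B) -> `|\prod_(i <- s) u i| <= (K + 3 * B) ^+ size s.
Proof.
move=> B1 K0 hu; elim: s => [|i s IH]; first by rewrite big_nil normr1 expr0.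
rewrite big_cons normrM exprS ler_pM// (le_trans (hu i))//; lra.
Qed.

(** Each correction [c i] is O(r^2), so a product of two of them is O(r^4) and only terms with a
    single correction remain. *)
Lemma prod_expansion (I : eqType) (s : seq I) (B K r : R) (a b c : I -> R) :
  1 <= B -> 0 <= K -> 0 <= r -> r <= 1 -> uniq s ->
  (forall i, `|a i| <= B) -> (forall i, `|b i| <= B) ->
  (forall i, `|c i| <= B * r ^+ 2) ->
  (forall i, `|a i - b i - c i| <= K * r ^+ 3) ->
  `|\prod_(i <- s) a i - \prod_(i <- s) b i
    - \sum_(j <- s) c j * \prod_(i <- s | i != j) b i|
  <= (K + 3 * B) ^+ size s * r ^+ 3.
Proof.
move=> B1 K0 r0 r1 us ha hb hc habc.
have B0 : 0 <= B by exact: le_trans B1.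
have BK0 : 0 <= K + 3 * B by lra.
have r20 : 0 <= r ^+ 2 by exact: sqr_ge0.
have r21 : r ^+ 2 <= 1 by rewrite exprn_ile1.
have r32 : r ^+ 3 <= r ^+ 2 by rewrite exprS ler_piMl.
have r4 : r ^+ 2 * r ^+ 2 <= r ^+ 3.
  by rewrite -exprD -[leLHS]/(r ^+ 4) exprS ler_piMl// exprn_ge0.
(* The induction also carries the size of the first-order sum, which is needed to bound the
   difference of the two products. *)
suff : `|\prod_(i <- s) a i - \prod_(i <- s) b i
      - \sum_(j <- s) c j * \prod_(i <- s | i != j) b i|
    <= (K + 3 * B) ^+ size s * r ^+ 3 /\
    `|\sum_(j <- s) c j * \prod_(i <- s | i != j) b i|
    <= (K + 3 * B) ^+ size s * r ^+ 2 by case.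
elim: s us => [_|i s IH /=/andP[nis us]].
  by rewrite !big_nil subrr subr0 normr0 expr0 !mul1r exprn_ge0.
have [IH1 IH2] := IH us.
have E : \sum_(j <- i :: s) c j * \prod_(k <- i :: s | k != j) b k =
    c i * \prod_(k <- s) b k + b i * \sum_(j <- s) c j * \prod_(k <- s | k != j) b k.
  rewrite big_cons big_cons eqxx/=; congr (_ * _ + _).
    rewrite big_seq_cond [RHS]big_seq; apply: eq_bigl => k.
    by case: eqVneq => [->|]; rewrite ?(negbTE nis)//= andbT.
  rewrite mulr_sumr big_seq [RHS]big_seq; apply: eq_bigr => j js.
  have ij : i != j by apply: contraNneq nis => ->.
  by rewrite big_cons ij mulrCA.
rewrite E !big_cons.
have PA := prod_bounded s B1 K0 ha; have PB := prod_bounded s B1 K0 hb.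
set A := \prod_(k <- s) a k in IH1 PA *; set P := \prod_(k <- s) b k in IH1 PB *.
set L := \sum_(j <- s) _ in IH1 IH2 *; set C := (K + 3 * B) ^+ size s in IH1 IH2 PA PB *.
have C0 : 0 <= C by rewrite exprn_ge0.
rewrite exprS -/C; split.
  (* The three summands contribute K, B and 2 B times C r^3, whence the base K + 3 B. *)
  rewrite (_ : _ - _ = (a i - b i - c i) * A + b i * (A - P - L) + c i * (A - P));
    last by ring.
  have AP : `|A - P| <= 2 * C * r ^+ 2.
    rewrite (_ : A - P = (A - P - L) + L); last by ring.
    apply: (le_trans (ler_normD _ _)).
    have : C * r ^+ 3 <= C * r ^+ 2 by rewrite ler_wpM2l.
    lra.
  have h1 : `|(a i - b i - c i) * A| <= K * r ^+ 3 * C by rewrite normrM ler_pM.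
  have h2 : `|b i * (A - P - L)| <= B * (C * r ^+ 3) by rewrite normrM ler_pM.
  have h3 : `|c i * (A - P)| <= 2 * B * C * r ^+ 3.
    apply: (@le_trans _ _ (B * r ^+ 2 * (2 * C * r ^+ 2))).
      by rewrite normrM ler_pM.
    rewrite (_ : _ * _ = 2 * B * C * (r ^+ 2 * r ^+ 2)); last by ring.
    by rewrite ler_wpM2l// !mulr_ge0.
  apply: (le_trans (ler_normD _ _)); apply: (le_trans (lerD (ler_normD _ _) (lexx _))).
  apply: (le_trans (lerD (lerD h1 h2) h3)).
  by rewrite le_eqVlt; apply/orP; left; apply/eqP; ring.
apply: (le_trans (ler_normD _ _)).
have h1 : `|c i * P| <= B * r ^+ 2 * C by rewrite normrM ler_pM.
have h2 : `|b i * L| <= B * (C * r ^+ 2) by rewrite normrM ler_pM.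
apply: (le_trans (lerD h1 h2)).
rewrite (_ : _ + _ = 2 * B * (C * r ^+ 2)); last by ring.
rewrite -[leRHS]mulrA ler_wpM2r//; last lra.
by rewrite mulr_ge0.
Qed.

Lemma prod_lipschitz (I : Type) (s : seq I) (B K r : R) (u v : I -> R) :
  1 <= B -> 0 <= K -> 0 <= r ->
  (forall i, `|u i| <= B) -> (forall i, `|v i| <= B) ->
  (forall i, `|u i - v i| <= K * r) ->
  `|\prod_(i <- s) u i - \prod_(i <- s) v i| <= (K + 3 * B) ^+ size s * r.
Proof.
move=> B1 K0 r0 hu hv huv.
elim: s => [|i s IH]; first by rewrite !big_nil subrr normr0 expr0 mul1r.
rewrite !big_cons /= exprS.
have U := prod_bounded s B1 K0 hu.
set C := (K + 3 * B) ^+ size s in IH U *.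
have C0 : 0 <= C by rewrite exprn_ge0//; lra.
rewrite (_ : _ - _ = (u i - v i) * \prod_(j <- s) u j
  + v i * (\prod_(j <- s) u j - \prod_(j <- s) v j)); last by ring.
apply: (le_trans (ler_normD _ _)).
have h1 : `|(u i - v i) * \prod_(j <- s) u j| <= K * r * C by rewrite normrM ler_pM.
have h2 : `|v i * (\prod_(j <- s) u j - \prod_(j <- s) v j)| <= B * (C * r).
  by rewrite normrM ler_pM.
apply: (le_trans (lerD h1 h2)).
rewrite (_ : _ + _ = (K + B) * (C * r)); last by ring.
rewrite -mulrA ler_wpM2r ?mulr_ge0//; lra.
Qed.

Definition taylor2_1d (phi phi'' : R -> R) (B K : R) :=
  [/\ forall x y, `|2^-1 * (phi (x + y) + phi (x - y)) - phi x
        - 2^-1 * phi'' x * y ^+ 2| <= K * `|y| ^+ 3,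
      forall x y, `|phi'' x - phi'' y| <= K * `|x - y|,
      forall x y, `|phi x - phi y| <= K * `|x - y|,
      forall x, `|phi x| <= B & forall x, `|phi'' x| <= B].

Lemma taylor2_1d_spline (a : R) : 1 <= a -> exists B K, [/\ 1 <= B, 0 <= K & forall c,
  taylor2_1d (fun t => spline (a * t + c)) (fun t => a ^+ 2 * spline'' (a * t + c)) B K].
Proof.
move=> a1; have a0 : 0 <= a by exact: le_trans a1.
have a21 : 1 <= a ^+ 2 by rewrite exprn_ege1.
have a23 : a ^+ 2 <= a ^+ 3 by rewrite [a ^+ 3]exprS ler_peMl// sqr_ge0.
have aa3 : a <= a ^+ 3 by rewrite [a ^+ 3]exprS ler_peMr.
exists (512 * a ^+ 2), (128 * a ^+ 3); split; [lra|lra|move=> c].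
have lin x y : a * x + c - (a * y + c) = a * (x - y) by ring.
split.
- move=> x y; rewrite (_ : a * (x + y) + c = a * x + c + a * y); last by ring.
  rewrite (_ : a * (x - y) + c = a * x + c - a * y); last by ring.
  have := spline_expansion (a * x + c) (a * y).
  rewrite exprMn normrM (ger0_norm a0) exprMn.
  rewrite (_ : 2^-1 * (a ^+ 2 * _) * _ =
    2^-1 * spline'' (a * x + c) * (a ^+ 2 * y ^+ 2)); last by ring.
  move=> /le_trans; apply; rewrite mulrA ler_wpM2r ?exprn_ge0// ler_wpM2r ?exprn_ge0//.
  lra.
- move=> x y; rewrite -mulrBr normrM ger0_norm ?sqr_ge0//.
  have := spline''_lipschitz (a * x + c) (a * y + c).
  rewrite lin normrM (ger0_norm a0) => h.
  apply: (@le_trans _ _ (a ^+ 2 * (16 * (a * `|x - y|)))).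
    by rewrite ler_wpM2l ?sqr_ge0.
  rewrite (_ : _ * _ = 16 * (a ^+ 3 * `|x - y|)); last by ring.
  by rewrite -mulrA ler_wpM2r ?mulr_ge0 ?exprn_ge0//; lra.
- move=> x y; have := spline_lipschitz (a * x + c) (a * y + c).
  rewrite lin normrM (ger0_norm a0) => /le_trans; apply.
  by rewrite mulrA ler_wpM2r// ler_wpM2l.
- by move=> x; apply: (le_trans (spline_bounded _)); lra.
- move=> x; rewrite normrM ger0_norm ?sqr_ge0// mulrC ler_wpM2r ?sqr_ge0//.
  by apply: (le_trans (spline''_bounded _)); lra.
Qed.

Lemma lipschitz_continuous1 (phi : R -> R) K : 0 <= K ->
  (forall x y, `|phi x - phi y| <= K * `|x - y|) -> continuous phi.
Proof.
move=> K0 lip x; apply/cvgrPdist_lt => e e0.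
have K1 : 0 < K + 1 by rewrite ltr_wpDl.
near=> y; apply: (le_lt_trans (lip _ _)).
apply: (@le_lt_trans _ _ ((K + 1) * `|x - y|)); first by rewrite ler_wpM2r// lerDl.
rewrite -ltr_pdivlMl// mulrC; near: y.
by apply/nbhs_ballP; exists (e / (K + 1)) => //=; exact: divr_gt0.
Unshelve. all: by end_near. Qed.

End products.

(** * Tensor products and quasi-interpolation *)

Section taylor2_products.
Context {R : realType} {d : nat}.
Implicit Types (x y : 'rV[R]_d).

(** The average over sign vectors of a product of one-variable functions factorises, by
    distributivity. *)
Lemma symmetrise_prod (phi : 'I_d -> R -> R) x y :
  symmetrise (fun z => \prod_i phi i ((x + z) ord0 i)) y =
  \prod_i (2^-1 * (phi i (x ord0 i + y ord0 i) + phi i (x ord0 i - y ord0 i))).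
Proof.
rewrite big_split/= prodr_const card_ord exprVn; congr (_ * _).
rewrite (eq_bigr (fun i => \sum_(b : bool) phi i (x ord0 i + (-1) ^+ b * y ord0 i))).
  rewrite bigA_distr_bigA/=; apply: eq_bigr => s _; apply: eq_bigr => i _.
  by rewrite !mxE.
move=> i _; rewrite big_bool/= expr1 expr0 mulN1r mul1r addrC//.
Qed.

(** In the factor d + 1, one unit would do for the expansion; the Lipschitz bound of the Laplacian
    adds up d products, each with one factor replaced by its second derivative. *)
Lemma taylor2_prod (phi phi'' : 'I_d -> R -> R) (B K : R) : 1 <= B -> 0 <= K ->
  (forall i, taylor2_1d (phi i) (phi'' i) B K) ->
  taylor2 (fun x => \prod_i phi i (x ord0 i))
    (fun j x => phi'' j (x ord0 j) * \prod_(i | i != j) phi i (x ord0 i))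
    ((d%:R + 1) * (K + 3 * B) ^+ d).
Proof.
move=> B1 K0 nphi.
have B0 : 0 <= B by exact: le_trans B1.
have C0 : 0 <= (K + 3 * B) ^+ d by rewrite exprn_ge0//; lra.
have szE : size (index_enum 'I_d) = d.
  by rewrite -[RHS]card_ord cardE /enum_mem size_filter count_predT.
have phic i : continuous (phi i).
  by have [_ _ lip _ _] := nphi i; exact: lipschitz_continuous1 lip.
split.
- move=> x y r r0 r1 yr; rewrite symmetrise_prod mulr_sumr.
  rewrite [X in _ - X](eq_bigr (fun j => 2^-1 * phi'' j (x ord0 j) * y ord0 j ^+ 2 *
     \prod_(i | i != j) phi i (x ord0 i))); last first.
    by move=> j _ /=; ring.
  apply: (@le_trans _ _ ((K + 3 * B) ^+ d * r ^+ 3)); last first.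
    by rewrite ler_wpM2r ?exprn_ge0// ler_peMl// lerDr.
  rewrite -[X in _ ^+ X * _]szE.
  apply: (prod_expansion (a := fun i => 2^-1 * (phi i (x ord0 i + y ord0 i)
      + phi i (x ord0 i - y ord0 i))) (b := fun i => phi i (x ord0 i))
      (c := fun j => 2^-1 * phi'' j (x ord0 j) * y ord0 j ^+ 2)) => //.
  + exact: index_enum_uniq.
  + move=> i; have [_ _ _ b _] := nphi i.
    rewrite normrM ger0_norm// ler_pdivrMl//.
    by rewrite (le_trans (ler_normD _ _))// mulr_natl mulr2n lerD.
  + by move=> i; have [_ _ _ b _] := nphi i.
  + move=> i; have [_ _ _ _ b] := nphi i.
    rewrite normrM ler_pM//.
      rewrite normrM ger0_norm// ler_pdivrMl// (le_trans (b _))//; lra.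
    by rewrite normrX ler_pXn2r// nnegrE.
  + move=> i; have [h _ _ _ _] := nphi i; apply: (le_trans (h _ _)).
    by rewrite ler_wpM2l// ler_pXn2r// nnegrE.
- move=> x y r r0 yr; rewrite -sumrB; apply: (le_trans (ler_norm_sum _ _ _)).
  apply: (@le_trans _ _ (\sum_(i < d) (K + 3 * B) ^+ d * r)); last first.
    rewrite sumr_const card_ord -[leLHS]mulr_natl mulrA ler_wpM2r// ler_wpM2r//.
    by rewrite lerDl.
  apply: ler_sum => j _.
  have E z : phi'' j (z ord0 j) * \prod_(i | i != j) phi i (z ord0 i) =
      \prod_i (if i == j then phi'' i (z ord0 i) else phi i (z ord0 i)).
    rewrite [RHS](bigD1 j)//= eqxx; congr (_ * _).
    by apply: eq_bigr => i /negbTE ->.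
  rewrite !E -[X in _ ^+ X * _]szE; apply: prod_lipschitz => // i.
  + by case: ifP => _; have [] := nphi i.
  + by case: ifP => _; have [] := nphi i.
  + have xy : `|(x + y) ord0 i - x ord0 i| <= r by rewrite mxE addrC addKr.
    have [_ l1 l2 _ _] := nphi i; case: ifP => _.
      by apply: (le_trans (l1 _ _)); rewrite ler_wpM2l.
    by apply: (le_trans (l2 _ _)); rewrite ler_wpM2l.
- apply: measurable_prod => i _.
  apply: (@measurableT_comp _ _ _ _ _ _ (phi i)); last exact: measurable_coord.
  exact: continuous_measurable_fun.
- apply: (@continuous_prod_fun _ _ _ _ (fun i (x : 'rV[R]_d) => phi i (x ord0 i))) => i x.
  exact: (cvg_comp _ _ (@continuous_coord R d i x) (phic i _)).
- exists ((K + 3 * B) ^+ size (index_enum 'I_d)) => x.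
  by apply: prod_bounded => // i; have [] := nphi i.
Qed.

(** Only [x] is confined to the cube: interpolation nodes, which lie in it, will be compared with
    evaluation points that may not. *)
Lemma uniform_continuity (U : 'rV[R]_d -> R) (L e : R) : continuous U -> 0 < e ->
  exists2 h, 0 < h & forall x y, (forall i, `|x ord0 i| <= L) ->
    (forall i, `|x ord0 i - y ord0 i| < h) -> `|U x - U y| < e.
Proof.
move=> cU e0.
have /compact_near_coveringP nc := @coord_compact R d L.
have [] := nc R (0^'+) (fun h x => forall y, (forall i, `|x ord0 i - y ord0 i| < h) ->
    `|U x - U y| < e) _.
  move=> x _.
  have /cvgrPdist_lt /(_ _ (ltac:(by rewrite divr_gt0) : 0 < e / 2)) := cU x.
  move=> /nbhs_ballP[r /= r0 rU].
  exists (ball x (r / 2), [set h | 0 < h < r / 2]).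
    split => /=; first by apply: nbhsx_ballx; rewrite divr_gt0.
    near=> h; apply/andP; split; near: h; first exact: nbhs_right_gt.
    by apply: nbhs_right_lt; rewrite divr_gt0.
  move=> [z h] [/= [_ xz] /andP[h0 hr]] y zy.
  have Uz : `|U x - U z| < e / 2.
    apply: rU; split=> // i j; apply: le_ball (xz i j).
    by rewrite ler_pdivrMr// ler_peMr ?ler1n// ltW.
  have Uy : `|U x - U y| < e / 2.
    apply: rU; split=> // i j; rewrite (splitr r).
    apply: ball_triangle (xz i j) _; rewrite (ord1 i) /ball/=.
    exact: lt_trans (zy j) hr.
  rewrite (_ : U z - U y = - (U x - U z) + (U x - U y)); last by ring.
  by rewrite (le_lt_trans (ler_normD _ _))// normrN (splitr e) ltrD.
move=> h /= h0 hU; exists (h / 2); first by rewrite divr_gt0.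
move=> x y xL xy; apply: (hU (h / 2)) => //=; last by rewrite divr_gt0.
by rewrite sub0r normrN gtr0_norm ?divr_gt0// ltr_pdivrMr// ltr_pMr// ltr1n.
Unshelve. all: by end_near. Qed.

(* Quasi-interpolation on the grid of mesh [1/a] by tensor products of cubic
   B-splines, which form a partition of unity on the cube of half-side [L]. *)
Lemma taylor2_approximation (U : 'rV[R]_d -> R) (L e : R) : 0 <= L -> 0 < e ->
  continuous U -> (forall x, 0 <= U x) ->
  exists f D K L', [/\ taylor2 f D K, 0 <= K,
    forall x i, L' < `|x ord0 i| -> f x = 0,
    forall x, 0 <= f x <= U x &
    forall x, (forall i, `|x ord0 i| <= L) -> U x - e <= f x].
Proof.
move=> L0 e0 cU U0.
have e20 : 0 < e / 2 by rewrite divr_gt0.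
have [h h0 hU] := uniform_continuity (L + 9) cU e20.
(* The support of a B-spline of mesh 1/a has width 4/a < h, so a nonzero weight places the node
   within h of the point. *)
pose a := Num.max 1 (5 / h).
have a1 : 1 <= a by rewrite le_max lexx.
have a0 : 0 < a by exact: lt_le_trans a1.
have ah : 4 / a < h.
  rewrite ltr_pdivrMr// mulrC -ltr_pdivrMr//; apply: (@lt_le_trans _ _ (5 / h)).
    by rewrite ltr_pM2r ?invr_gt0// ltr_nat.
  by rewrite le_max lexx orbT.
(* The margin 3 is where [cdf_spline] reaches 1: on the cube of half-side [L], a x_i + n is at least
   3 and a x_i - n is at most 0, so the weights sum to 1. *)
pose n := (Num.truncn (a * L + 3)).+1.
have n1 : a * L + 3 < n%:R by exact: truncnS_gt.
have n2 : n%:R <= a * L + 4.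
  rewrite /n -natr1 (_ : a * L + 4 = a * L + 3 + 1); last by ring.
  by rewrite lerD2r truncn_le// addr_ge0// mulr_ge0// ltW.
pose m := (2 * n)%N.
pose w (k : {ffun 'I_d -> 'I_m}) (x : 'rV[R]_d) : R :=
  \prod_i spline (a * x ord0 i + (n%:R - (k i)%:R)).
pose p (k : {ffun 'I_d -> 'I_m}) : 'rV[R]_d := \row_i (((k i)%:R - n%:R) / a).
(* [U] varies by less than e/2 between a node and the support of its weight, so lowering by e/2
   gives a minorant that loses at most [e]; the positive part keeps [f] nonnegative. *)
pose g k := Num.max (U (p k) - e / 2) 0.
pose f x := \sum_k g k * w k x.
have w0 k x : 0 <= w k x by rewrite prodr_ge0// => i _; exact: spline_ge0.
have g0 k : 0 <= g k by rewrite le_max lexx orbT.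
have pL k i : `|p k ord0 i| <= L + 9.
  rewrite mxE normrM normfV (gtr0_norm a0) ler_pdivrMr//.
  apply: (@le_trans _ _ n%:R).
    rewrite ler_norml; apply/andP; split; first by rewrite lerBrDr addNr.
    rewrite lerBlDr -natrD ler_nat addnn -mul2n; exact: ltnW (ltn_ord _).
  have := a1; nra.
have wsupp k x : w k x != 0 -> `|U (p k) - U x| < e / 2.
  move=> /prodf_neq0 wk; apply: hU => // i; rewrite mxE.
  have := wk i isT; have [|/spline_eq0 ->] := boolP (0 < a * x ord0 i +
    (n%:R - (k i)%:R) < 4); last by rewrite eqxx.
  move=> /andP[s0 s4] _; apply: lt_trans ah.
  rewrite ltr_pdivlMr// -{2}(gtr0_norm a0) -normrM.
  rewrite (_ : _ * a = - (a * x ord0 i + (n%:R - (k i)%:R))); last first.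
    by field; rewrite gt_eqF.
  by rewrite normrN gtr0_norm.
have wsum x : \sum_k w k x = \prod_i (cdf_spline (a * x ord0 i + n%:R)
    - cdf_spline (a * x ord0 i + n%:R - m%:R)).
  rewrite -(bigA_distr_bigA (fun i (k : 'I_m) =>
    spline (a * x ord0 i + (n%:R - k%:R))))/=.
  apply: eq_bigr => i _; rewrite -sum_spline; apply: eq_bigr => k _.
  by rewrite addrA.
have wsum1 x : \sum_k w k x <= 1.
  rewrite wsum prodr_ile1// => i _; set t := _ + n%:R.
  rewrite -{1}sum_spline sumr_ge0 => [|k _]; last exact: spline_ge0.
  by rewrite lerBlDr (le_trans (cdf_spline_le1 t))// lerDl cdf_spline_ge0.
have wsumE x : (forall i, `|x ord0 i| <= L) -> \sum_k w k x = 1.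
  move=> xL; rewrite wsum big1// => i _.
  have : `|a * x ord0 i| <= a * L by rewrite normrM (gtr0_norm a0) ler_wpM2l// ltW.
  rewrite ler_norml => /andP[l1 l2].
  rewrite cdf_spline_ge3; last lra.
  rewrite cdf_spline_le0 ?subr0// /m mul2n -addnn natrD; lra.
have [B [K [B1 K0 nsp]]] := taylor2_1d_spline a1.
have nw (k : {ffun 'I_d -> 'I_m}) :=
  taylor2_prod B1 K0 (fun i => nsp (n%:R - (k i)%:R)).
have nf := taylor2_sum (index_enum {ffun 'I_d -> 'I_m}) g nw.
exists f; eexists; eexists; exists ((m%:R + 4) / a); split.
- exact: nf.
- apply: sumr_ge0 => k _; rewrite mulr_ge0// mulr_ge0 ?addr_ge0//.
  by rewrite exprn_ge0//; lra.
- move=> x i; rewrite ltr_pdivrMr// -{1}(gtr0_norm a0) -normrM mulrC => xi.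
  rewrite /f big1// => k _; rewrite /w (bigD1 i)//= spline_eq0 ?mul0r ?mulr0//.
  have km : (k i)%:R <= m%:R :> R by rewrite ler_nat ltnW.
  have nm : n%:R <= m%:R :> R by rewrite ler_nat /m mul2n -addnn leq_addl.
  have k0 : 0 <= (k i)%:R :> R by [].
  have n0 : 0 <= n%:R :> R by [].
  apply/negP => /andP[s0 s4].
  by move: xi; rewrite ltNge ler_norml => /negP; apply; lra.
- move=> x; rewrite sumr_ge0/= => [|k _]; last by rewrite mulr_ge0.
  apply: (@le_trans _ _ (\sum_k U x * w k x)); last first.
    by rewrite -mulr_sumr ler_piMr.
  apply: ler_sum => k _; have [->|/wsupp] := eqVneq (w k x) 0.
    by rewrite !mulr0.
  rewrite ltr_norml => /andP[_ h1]; rewrite ler_wpM2r// ge_max U0 andbT; lra.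
- move=> x xL; rewrite -[leLHS]mulr1 -(wsumE x xL) mulr_sumr.
  apply: ler_sum => k _; have [->|/wsupp] := eqVneq (w k x) 0.
    by rewrite !mulr0.
  rewrite ltr_norml => /andP[h1 _]; rewrite ler_wpM2r// le_max; apply/orP; left; lra.
Qed.

End taylor2_products.

(** * Points of low potential *)

Section walk_moments.
Context {R : realType} {d : nat}.
Implicit Types (x y : 'rV[R]_d) (f g : 'rV[R]_d -> R) (h : R).

Definition sqn x : R := \sum_i x ord0 i ^+ 2.

Lemma sqn_ge0 x : 0 <= sqn x.
Proof. by rewrite sumr_ge0// => i _; exact: sqr_ge0. Qed.

Lemma sqn_enorm x : sqn x = enorm x ^+ 2.
Proof. by rewrite enorm_sqr. Qed.

Lemma walkD h f g x : walk h (fun z => f z + g z) x = walk h f x + walk h g x.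
Proof. by rewrite /walk big_split/= mulrDr. Qed.

Lemma walkZ h a f x : walk h (fun z => a * f z) x = a * walk h f x.
Proof. by rewrite /walk -mulr_sumr mulrCA. Qed.

Lemma walk_cst h a x : (0 < d)%N -> walk h (fun=> a) x = a.
Proof.
move=> d0; have dR : 0 < d%:R :> R by rewrite ltr0n.
rewrite /walk sumr_const (eq_card (B := predT))// card_prod card_ord card_bool.
by rewrite -[a *+ _]mulr_natl natrM [d%:R * 2]mulrC mulKf// mulf_neq0// gt_eqF.
Qed.

Lemma iter_walkD h f g n x : iter n (walk h) (fun z => f z + g z) x =
  iter n (walk h) f x + iter n (walk h) g x.
Proof.
by elim: n x => // n IH x; rewrite !iterS -walkD; congr walk; apply/funext => z; exact: IH.
Qed.

Lemma iter_walkZ h a f n x :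
  iter n (walk h) (fun z => a * f z) x = a * iter n (walk h) f x.
Proof.
by elim: n x => // n IH x; rewrite !iterS -walkZ; congr walk; apply/funext => z; exact: IH.
Qed.

Lemma iter_walk_cst h a n x : (0 < d)%N -> iter n (walk h) (fun=> a) x = a.
Proof.
move=> d0; elim: n x => // n IH x; rewrite iterS -[RHS](walk_cst h a x d0).
by congr walk; apply/funext => z; exact: IH.
Qed.

Lemma le_iter_walk h f g n : (forall x, f x <= g x) ->
  forall x, iter n (walk h) f x <= iter n (walk h) g x.
Proof. by move=> fg; elim: n => // n IH; exact: le_walk. Qed.

Lemma iter_walk_translate h f c n x :
  iter n (walk h) (fun z => f (c + z)) x = iter n (walk h) f (c + x).
Proof.
elim: n x => // n IH x; rewrite !iterS /walk; congr (_ * _).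
by apply: eq_bigr => p _; rewrite IH addrA.
Qed.

Lemma iter_walk_sum_translate h f (cs : seq 'rV[R]_d) n x : (0 < d)%N ->
  iter n (walk h) (fun z => \sum_(c <- cs) f (c + z)) x =
  \sum_(c <- cs) iter n (walk h) f (c + x).
Proof.
move=> d0; elim: cs => [|c cs IH].
  by under eq_fun do rewrite big_nil; rewrite big_nil iter_walk_cst.
under eq_fun do rewrite big_cons.
by rewrite big_cons -IH -iter_walk_translate -iter_walkD.
Qed.

Lemma sqn_step h x i b : sqn (x + h *: unit_step (i, b)) =
  sqn x + 2 * ((-1) ^+ b * h * x ord0 i) + h ^+ 2.
Proof.
rewrite /sqn (bigD1 i)//= [in RHS](bigD1 i)//= !mxE !eqxx/= mulr1.
rewrite (eq_bigr (fun j => x ord0 j ^+ 2)) => [|j ji]; last first.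
  by rewrite !mxE (negbTE ji) andbF !mulr0 addr0.
have e : ((-1) ^+ b) ^+ 2 = 1 :> R by rewrite sqrr_sign.
rewrite sqrrD exprMn e mulr1 -mulr_natl; ring.
Qed.

Lemma walk_sqn h x : (0 < d)%N -> walk h sqn x = sqn x + h ^+ 2.
Proof.
move=> d0; have dR : 0 < d%:R :> R by rewrite ltr0n.
rewrite /walk (eq_bigr (fun p => sqn (x + h *: unit_step (p.1, p.2)))) => [|[]//].
rewrite -(pair_bigA _ (fun i b => sqn (x + h *: unit_step (i, b))))/=.
rewrite (eq_bigr (fun=> 2 * (sqn x + h ^+ 2))) => [|i _]; last first.
  by rewrite big_bool/= !sqn_step expr1 expr0; ring.
rewrite sumr_const card_ord -[(2 * _) *+ d]mulr_natl; field.
by rewrite gt_eqF.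
Qed.

Lemma walk_sqn2 h x : (0 < d)%N ->
  walk h (fun z => sqn z ^+ 2) x <= sqn x ^+ 2 + 6 * h ^+ 2 * sqn x + h ^+ 4.
Proof.
move=> d0; have dR : 0 < d%:R :> R by rewrite ltr0n.
rewrite /walk (eq_bigr (fun p => sqn (x + h *: unit_step (p.1, p.2)) ^+ 2)) => [|[]//].
rewrite -(pair_bigA _ (fun i b => sqn (x + h *: unit_step (i, b)) ^+ 2))/=.
rewrite (eq_bigr (fun i => 2 * (sqn x + h ^+ 2) ^+ 2 + 8 * h ^+ 2 * x ord0 i ^+ 2))
    => [|i _]; last first.
  by rewrite big_bool/= !sqn_step expr1 expr0; ring.
rewrite big_split/= sumr_const card_ord -[(2 * _) *+ d]mulr_natl -mulr_sumr -/(sqn x).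
rewrite [leLHS](_ : _ = (sqn x + h ^+ 2) ^+ 2 + d%:R^-1 * (4 * h ^+ 2 * sqn x));
  last by field; rewrite gt_eqF.
have : d%:R^-1 * (4 * h ^+ 2 * sqn x) <= 4 * h ^+ 2 * sqn x.
  apply: ler_piMl; last by rewrite invf_le1// ler1n.
  by rewrite mulr_ge0 ?sqn_ge0// mulr_ge0// sqr_ge0.
rewrite sqrrD -mulr_natl -exprM; lra.
Qed.

Lemma iter_walk_sqn h n : (0 < d)%N -> iter n (walk h) sqn 0 = n%:R * h ^+ 2.
Proof.
move=> d0; suff h' x : iter n (walk h) sqn x = sqn x + n%:R * h ^+ 2.
  rewrite h' /sqn big1 ?add0r// => i _; by rewrite mxE expr0n.
elim: n x => [|n IH] x; first by rewrite mul0r addr0.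
rewrite iterS (_ : iter n (walk h) sqn = fun z => sqn z + n%:R * h ^+ 2);
  last by apply/funext.
by rewrite walkD walk_cst// walk_sqn// -nat1r; ring.
Qed.

(** With t = n h^2, the bound 3 t^2 is the fourth moment of a Gaussian of variance t on the line. A
    step adds at most 6 n h^4 + h^4, while the bound grows by 6 n h^4 + 3 h^4. *)
Lemma iter_walk_sqn2 h n : (0 < d)%N ->
  iter n (walk h) (fun z => sqn z ^+ 2) 0 <= 3 * (n%:R * h ^+ 2) ^+ 2.
Proof.
move=> d0; elim: n => [|n IH].
  rewrite /= /sqn big1 => [|i _]; last by rewrite mxE expr0n.
  by rewrite mul0r !expr0n/= mulr0.
rewrite iterSr.
apply: (@le_trans _ _ (iter n (walk h)
    (fun z => sqn z ^+ 2 + (6 * h ^+ 2 * sqn z + h ^+ 4)) 0)).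
  apply: le_iter_walk => x; rewrite addrA; exact: walk_sqn2.
rewrite iter_walkD iter_walkD iter_walk_cst// iter_walkZ iter_walk_sqn//.
apply: (le_trans (lerD IH (lexx _))).
rewrite -nat1r -subr_ge0 (_ : _ - _ = 2 * h ^+ 4); last by ring.
by rewrite mulr_ge0// -[4%N]/(2 * 2)%N exprM sqr_ge0.
Qed.

End walk_moments.

(** * Truncated potentials *)

Section low_potential.
Context {R : realType} {d : nat}.
Implicit Types (W : 'rV[R]_d -> \bar R) (x z : 'rV[R]_d).

(** The real-valued minimum of [W] and [M]; the case [+oo] is separate because [fine +oo] is 0. *)
Definition trunc W (M : R) x : R :=
  if W x == +oo%E then M else Num.min (fine (W x)) M.

Lemma trunc_le_fun W (b M : R) x : (b%:E <= W x)%E -> ((trunc W M x)%:E <= W x)%E.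
Proof.
rewrite /trunc; case: (W x) => [w _|_|]; last by rewrite leeNy_eq.
  by rewrite /= lee_fin ge_min lexx.
by rewrite leey.
Qed.

Lemma trunc_ge W (b M : R) x : b <= M -> (b%:E <= W x)%E -> b <= trunc W M x.
Proof.
rewrite /trunc => bM; case: (W x) => [w bw|//|]; last by rewrite leeNy_eq.
by rewrite /= le_min bM andbT -lee_fin.
Qed.

Lemma truncP W (b M : R) x : (b%:E <= W x)%E ->
  (W x < M%:E)%E /\ trunc W M x = fine (W x) \/ (M%:E <= W x)%E /\ trunc W M x = M.
Proof.
rewrite /trunc => bW; have [WM|WM] := ltP (W x) M%:E; [left|right]; split => //.
  move: bW WM; case: (W x) => [w _|//|]; last by rewrite leeNy_eq.
  by rewrite lte_fin => /ltW wM /=; rewrite min_l.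
move: WM; case: (W x) => [w|//|]; last by rewrite leeNy_eq.
by rewrite lee_fin /= => wM; rewrite min_r.
Qed.

(** Since [W 0 = +oo], lower semicontinuity makes [W] exceed [M] near the origin, and the truncation
    is constant there. *)
Lemma continuous_trunc W M : lower_semicontinuous W -> C1_off_origin W ->
  W 0 = +oo%E -> continuous (trunc W M).
Proof.
move=> Wl [Wfin Wdiff] W0 x; have [->|x0] := eqVneq (x : 'rV[R]_d) 0.
  have M0 : (M%:E < W 0%R)%E by rewrite W0 ltry.
  have [V V0 VM] := Wl _ _ M0.
  rewrite /continuous_at {2}/trunc W0 eqxx.
  have cM : cst M @ (0 : 'rV[R]_d) --> M by exact: (@cst_continuous 'rV[R]_d R M 0).
  have e : \forall y \near (0 : 'rV[R]_d), cst M y = trunc W M y.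
    apply: filterS V0 => y /VM; rewrite /trunc.
    by case: (W y) => [w|//|//]; rewrite lte_fin => /ltW wM /=; rewrite min_r.
  exact: cvg_trans (near_eq_cvg e) cM.
have cW : {for x, continuous (fine \o W)}.
  by apply: differentiable_continuous; case: (Wdiff x x0).
have Wne y : y != 0 -> trunc W M y = Num.min (fine (W y)) M.
  by move=> y0; rewrite /trunc; have := Wfin y y0; case: (W y).
rewrite /continuous_at (Wne x x0).
have cm : (fun y => Num.min (fine (W y)) M) @ x --> Num.min (fine (W x)) M.
  exact: (@continuous_min R 'rV[R]_d (fine \o W) (cst M) x cW (@cst_continuous 'rV[R]_d R M x)).
have e : \forall y \near x, Num.min (fine (W y)) M = trunc W M y.
  have : open_nbhs x [set y | y != 0].
    split => //; rewrite (_ : [set _ | _] = ~` [set 0]).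
      rewrite openC; apply: accessible_closed_set1; apply: hausdorff_accessible.
      exact: norm_hausdorff.
    by apply/seteqP; split => y /= /eqP.
  by move=> /open_nbhs_nbhs; apply: filterS => y /= /Wne.
exact: cvg_trans (near_eq_cvg e) cm.
Qed.

End low_potential.

Section low_potential_nearby.
Context {R : realType} {d : nat}.
Implicit Types (W : 'rV[R]_d -> \bar R) (x z : 'rV[R]_d).

(** Used in the converse direction: when the truncated sum is small, no term has been truncated. *)
Lemma sum_trunc_ge W (b M : R) (cs : seq 'rV[R]_d) z c0 :
  b <= M -> (forall x, b%:E <= W x)%E ->
  c0 \in cs -> (M%:E <= W (c0 + z)%R)%E ->
  M - (size cs)%:R * `|b| <= \sum_(c <- cs) trunc W M (c + z).
Proof.
move=> bM Wb c0cs MW.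
have tb c : - `|b| <= trunc W M (c + z).
  rewrite (le_trans _ (trunc_ge bM (Wb _)))// lerNl.
  by rewrite (le_trans (ler_norm _))// normrN.
rewrite (big_rem c0)//=; apply: lerD.
  by have [[]|[_ ->//]] := truncP M (Wb (c0 + z)); rewrite ltNge MW.
apply: (@le_trans _ _ (\sum_(c <- rem c0 cs) - `|b|)); last by apply: ler_sum.
rewrite big_const_seq count_predT iter_addr_0 mulNrn -[`|b| *+ _]mulr_natl lerN2.
by rewrite ler_wpM2r// ler_nat size_rem// leq_pred.
Qed.

(* Suppose the bound fails on the whole annulus.  The smooth function [f] below
   [W] then dominates, around every point of [cs] simultaneously, a quartic [p]
   in |z| that is positive only inside the annulus; averaging along the random
   walk up to time [t] contradicts [walk_comparison]. *)
Lemma low_potential_nearby W (b C t : R) (cs : seq 'rV[R]_d) :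
  (0 < d)%N -> 0 <= C -> lower_semicontinuous W -> locally_integrable_rV W ->
  (forall x, b%:E <= W x)%E -> (forall x, laplacian0 W x <= C%:E)%E ->
  C1_off_origin W -> W 0 = +oo%E -> 0 < t -> (0 < size cs)%N ->
  (forall c, c \in cs -> W c \is a fin_num) ->
  (forall z, (forall c, c \in cs -> W (c + z) \is a fin_num) ->
    \sum_(c <- cs) fine (W c) <= \sum_(c <- cs) fine (W (c + z))) ->
  exists z, [/\ t / 4 < sqn z, sqn z < 12 * t,
    forall c, c \in cs -> W (c + z) \is a fin_num &
    \sum_(c <- cs) fine (W (c + z)) <= \sum_(c <- cs) fine (W c)
      + (size cs)%:R * t * (6 * (8 * d%:R ^+ 3 * C) + 13)].
Proof.
move=> d0 C0 Wl Wloc Wb WC WC1 W0 t0 s0 csfin minP.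
set C1 := 8 * d%:R ^+ 3 * C; set P := \sum_(c <- cs) fine (W c).
set s : R := (size cs)%:R.
have C10 : 0 <= C1 by rewrite !mulr_ge0// exprn_ge0.
have s1 : 1 <= s by rewrite ler1n.
have st0 : 0 < s * t by rewrite mulr_gt0// (lt_le_trans ltr01).
(* The 6 is a product: the quartic [p] below is at most 3 and its average is at least 1/2. The 2
   exceeds the 1 in [Gup] by what is lost in replacing truncations by [f]. *)
pose A := 6 * (s * t) * (C1 + 2).
have A0 : 0 < A by rewrite !mulr_gt0//; lra.
(* One truncated term would give a sum of at least M - s |b|, which exceeds P + A + s t. *)
pose M := `|P| + A + s * t + s * `|b| + `|b| + 1.
have sb0 : 0 <= s * `|b| by rewrite mulr_ge0//; lra.
have bb : b <= `|b| := ler_norm b.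
have PP : P <= `|P| := ler_norm P.
have bM : b <= M by rewrite /M; have := normr_ge0 P; lra.
have tfin z : (forall c, c \in cs -> (W (c + z)%R < M%:E)%E) ->
    (forall c, c \in cs -> W (c + z) \is a fin_num) /\
    \sum_(c <- cs) trunc W M (c + z) = \sum_(c <- cs) fine (W (c + z)).
  move=> WM; split => [c ccs|].
    by rewrite fin_real// (lt_le_trans (ltNyr b) (Wb _))/= (lt_trans (WM c ccs))// ltry.
  rewrite big_seq [RHS]big_seq; apply: eq_bigr => c ccs.
  have [[_ //]|[]] := truncP M (Wb (c + z)).
  by rewrite leNgt (WM c ccs).
have tlow z : \sum_(c <- cs) trunc W M (c + z) <= P + A + s * t ->
    forall c, c \in cs -> (W (c + z)%R < M%:E)%E.
  move=> le c ccs; rewrite ltNge; apply/negP => Mc.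
  have := sum_trunc_ge bM Wb ccs Mc; rewrite -/s.
  by have : 0 <= `|b| := normr_ge0 b; rewrite /M in le *; lra.
(* A smaller sum would contain no truncated term, contradicting the minimality of [P]. *)
have tP z : P <= \sum_(c <- cs) trunc W M (c + z).
  rewrite leNgt; apply/negP => lt.
  have /tlow/tfin[fz e] : \sum_(c <- cs) trunc W M (c + z) <= P + A + s * t by lra.
  by have := minP z fz; rewrite -/P -e leNgt lt.
have Psb : 0 <= P - s * b.
  rewrite subr_ge0 /P /s mulr_natl -iter_addr_0 -(count_predT cs) -big_const_seq.
  rewrite big_seq [leRHS]big_seq; apply: ler_sum => c ccs.
  by rewrite -lee_fin fineK ?csfin.
(* The cube of half-side [L0] contains the annulus; outside it |z|^2 is at least 24 t, and the last
   term makes the quartic negative enough to outweigh P - s b. *)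
pose L0 := 24 * t + 1 + 3 * t * (P - s * b) / A.
have L00 : 0 <= 3 * t * (P - s * b) / A.
  by rewrite divr_ge0 ?(ltW A0)// mulr_ge0// mulr_ge0// ltW.
pose U x := trunc W M x - b.
have cU : continuous U.
  move=> x; have tx := @continuous_trunc R d W M Wl WC1 W0 (x : 'rV[R]_d).
  exact: (cvgB tx (@cst_continuous 'rV[R]_d R b x)).
have U0 x : 0 <= U x by rewrite subr_ge0 trunc_ge.
have Lc0 : 0 <= L0 + \sum_(c <- cs) \sum_i `|c ord0 i|.
  by rewrite addr_ge0 ?sumr_ge0// => [|c _]; [rewrite /L0; lra|rewrite sumr_ge0].
have [f [D [K [L' [nf K0 fL' f0U fU]]]]] := taylor2_approximation Lc0 t0 cU U0.
(* Chosen after [K]: with n h^2 = t, both h and 2 K h are at most 1, so the accumulated error n 2 K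
   h^3 is at most t. *)
pose n := (Num.truncn (t * (1 + (2 * K) ^+ 2))).+1.
have n0 : 0 < n%:R :> R by rewrite ltr0n.
have nK : t * (1 + (2 * K) ^+ 2) < n%:R by exact: truncnS_gt.
pose h := Num.sqrt (t / n%:R).
have h0 : 0 <= h by exact: sqrtr_ge0.
have h2 : h ^+ 2 = t / n%:R by rewrite sqr_sqrtr// divr_ge0// ltW.
have nh2 : n%:R * h ^+ 2 = t by rewrite h2 mulrC divfK// gt_eqF.
have h2K : h ^+ 2 * (1 + (2 * K) ^+ 2) <= 1.
  by rewrite h2 mulrAC ler_pdivrMr// mul1r ltW.
have h1 : h <= 1.
  rewrite -(@ler_pXn2r _ 2)// ?nnegrE// expr1n; apply: le_trans h2K.
  by rewrite ler_peMr ?sqr_ge0// lerDl sqr_ge0.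
have Kh1 : 2 * K * h <= 1.
  rewrite -(@ler_pXn2r _ 2)// ?nnegrE ?mulr_ge0// expr1n exprMn mulrC.
  by apply: le_trans h2K; rewrite ler_wpM2l ?sqr_ge0// lerDr.
have fW x : ((b + f x)%:E <= W x)%E.
  apply: le_trans (trunc_le_fun M (Wb x)); rewrite lee_fin.
  by have /andP[_] := f0U x; rewrite /U; lra.
have cmp := walk_comparison d0 C0 h0 h1 K0 Wl Wloc Wb WC nf fL' fW n.
pose G z := \sum_(c <- cs) f (c + z).
have Gup : iter n (walk h) G 0 <= P - s * b + s * t * (C1 + 1).
  rewrite /G iter_walk_sum_translate//.
  apply: (@le_trans _ _ (\sum_(c <- cs) (fine (W c) + (- b + t * (C1 + 1))))).
    rewrite big_seq [leRHS]big_seq; apply: ler_sum => c ccs; rewrite addr0.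
    have := cmp c; rewrite -{1}(fineK (csfin c ccs)) -EFinD lee_fin mulrDr.
    rewrite mulrA nh2 -/C1 (_ : n%:R * (2 * K * h ^+ 3) = n%:R * h ^+ 2 * (2 * K * h));
      last by ring.
    rewrite nh2; have : t * (2 * K * h) <= t * 1 by rewrite ler_wpM2l// ltW.
    lra.
  rewrite big_split/= -/P big_const_seq count_predT iter_addr_0 -[(_ + _) *+ _]mulr_natl -/s.
  by rewrite le_eqVlt; apply/orP; left; apply/eqP; ring.
clear cmp nK n0 h2K h2 h1 h0 Kh1 K0 bb PP bM sb0 s1 C10 C0.
have [[z [z1 z2 zG]]|no] := pselect (exists z, [/\ t / 4 < sqn z, sqn z < 12 * t &
    G z <= P - s * b + A]).
  have zL i : `|z ord0 i| <= L0.
    apply: (le_trans (ler_coord_enorm _ _)).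
    rewrite -(@ler_pXn2r _ 2)// ?nnegrE ?enorm_ge0//; last by rewrite /L0; lra.
    rewrite -sqn_enorm (le_trans (ltW z2))//.
    have : 1 <= L0 by rewrite /L0; lra.
    have : 12 * t <= L0 by rewrite /L0; lra.
    move=> l1 l2; apply: (le_trans l1); rewrite expr2 ler_peMr//; lra.
  have Gt : \sum_(c <- cs) trunc W M (c + z) <= P + A + s * t.
    have : \sum_(c <- cs) (trunc W M (c + z) + (- b - t)) <= G z.
      rewrite /G big_seq [leRHS]big_seq; apply: ler_sum => c ccs.
      have : U (c + z) - t <= f (c + z).
        apply: fU => i; rewrite mxE (le_trans (ler_normD _ _))// addrC lerD//.
        rewrite (big_rem c)//= (bigD1 i)//= -addrA lerDl addr_ge0// sumr_ge0// => c' _.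
        by rewrite sumr_ge0.
      by rewrite /U; lra.
    rewrite big_split/= big_const_seq count_predT iter_addr_0 -[(_ - t) *+ _]mulr_natl -/s.
    lra.
  have [fz e] := tfin z (tlow z Gt).
  exists z; split => //; rewrite -e (le_trans Gt)// -addrA lerD2l /A.
  by rewrite le_eqVlt; apply/orP; left; apply/eqP; ring.
exfalso.
(* With u = |z|^2, u - u^2 / (12 t) is at most 3 t, with equality at u = 6 t, and it is nonpositive
   for u at least 12 t. By the moments t and at most 3 t^2, [p] has average at least 1 - 1/4 - 1/4 =
   1/2. *)
pose p z := (sqn z - sqn z ^+ 2 / (12 * t) - t / 4) / t.
(* As [p] is at most 3, B p fits below the gap A + s t in the annulus, while B / 2 = s t (C1 + 2) +
   s t / 6 is more than [Gup] allows. *)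
pose B := (A + s * t) / 3.
have B0 : 0 < B by rewrite divr_gt0// addr_gt0.
have p3 z : p z <= 3.
  rewrite ler_pdivrMr//.
  have : sqn z - sqn z ^+ 2 / (12 * t) <= 3 * t.
    rewrite -subr_ge0 (_ : _ - _ = (sqn z - 6 * t) ^+ 2 / (12 * t)).
      by rewrite divr_ge0 ?sqr_ge0// mulr_ge0// ltW.
    by field; rewrite gt_eqF.
  lra.
have q12 z : sqn z - sqn z ^+ 2 / (12 * t) = sqn z * (12 * t - sqn z) / (12 * t).
  by field; rewrite gt_eqF.
have pout z : ~ (t / 4 < sqn z /\ sqn z < 12 * t) -> p z <= 0.
  move=> out; rewrite pmulr_lle0 ?invr_gt0//.
  have [z1|z1] := leP (sqn z) (t / 4).
    have : 0 <= sqn z ^+ 2 / (12 * t) by rewrite divr_ge0 ?sqr_ge0// mulr_ge0// ltW.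
    lra.
  have z2 : 12 * t <= sqn z by rewrite leNgt; apply/negP => z2; exact: out.
  rewrite q12; have : sqn z * (12 * t - sqn z) / (12 * t) <= 0.
    rewrite pmulr_lle0 ?invr_gt0 ?mulr_gt0// mulr_ge0_le0 ?sqn_ge0//; lra.
  lra.
have Glow z : (P - s * b - s * t) + B * p z <= G z.
  have [[z1 z2]|out] := pselect (t / 4 < sqn z /\ sqn z < 12 * t).
    have : P - s * b + A < G z.
      by rewrite ltNge; apply/negP => Gz; apply: no; exists z.
    have : B * p z <= B * 3 by rewrite ler_wpM2l// ltW.
    rewrite /B; lra.
  have Bp : B * p z <= 0 by rewrite pmulr_rle0// pout.
  have [zL|/existsNP[i /negP]] := pselect (forall i, `|z ord0 i| <= L0).
    have : \sum_(c <- cs) (trunc W M (c + z) + (- b - t)) <= G z.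
      rewrite /G big_seq [leRHS]big_seq; apply: ler_sum => c ccs.
      have : U (c + z) - t <= f (c + z).
        apply: fU => i; rewrite mxE (le_trans (ler_normD _ _))// addrC lerD//.
        rewrite (big_rem c)//= (bigD1 i)//= -addrA lerDl addr_ge0// sumr_ge0// => c' _.
        by rewrite sumr_ge0.
      by rewrite /U; lra.
    rewrite big_split/= big_const_seq count_predT iter_addr_0 -[(_ - t) *+ _]mulr_natl -/s.
    have := tP z; lra.
  (* Beyond the cube only [G z >= 0] is known; there |z|^2 >= 24 t gives p z <= - |z|^2 / t. *)
  rewrite -ltNge => zL.
  have G0 : 0 <= G z by rewrite sumr_ge0// => c _; case/andP: (f0U (c + z)).
  apply: le_trans G0.
  have L1 : 1 <= L0 by rewrite /L0; lra.
  have zL2 : L0 <= sqn z.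
    apply: (@le_trans _ _ (L0 ^+ 2)); first by rewrite expr2 ler_peMr//; lra.
    rewrite sqn_enorm ler_pXn2r ?nnegrE ?enorm_ge0//; last lra.
    by rewrite (le_trans (ltW zL))// ler_coord_enorm.
  have pz : p z <= - (sqn z / t).
    rewrite /p -[leRHS]mulNr ler_wpM2r ?invr_ge0 ?(ltW t0)//.
    have : sqn z * (12 * t - sqn z) / (12 * t) <= - sqn z.
      rewrite ler_pdivrMr ?mulr_gt0// mulNr -mulrN ler_wpM2l ?sqn_ge0//.
      by rewrite /L0 in zL2; lra.
    rewrite q12; lra.
  have : B * (sqn z / t) >= P - s * b.
    apply: (@le_trans _ _ (A / 3 * (3 * t * (P - s * b) / A / t))).
      rewrite le_eqVlt; apply/orP; left; apply/eqP.
      by field; rewrite !gt_eqF.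
    apply: ler_pM; [by rewrite divr_ge0// ltW|by rewrite divr_ge0// ltW| |].
      by rewrite /B ler_pM2r ?invr_gt0//; lra.
    rewrite ler_pM2r ?invr_gt0//; apply: le_trans zL2; rewrite /L0; lra.
  have : B * p z <= - (B * (sqn z / t)) by rewrite -mulrN ler_wpM2l// ltW.
  lra.
have Gl := le_iter_walk h n Glow (0 : 'rV[R]_d).
have pE : 2^-1 <= iter n (walk h) p 0.
  rewrite (_ : p = fun z => t^-1 * (sqn z + (- (12 * t)^-1 * sqn z ^+ 2 + - (t / 4))));
    last by apply/funext => z; rewrite /p; field; rewrite gt_eqF.
  rewrite iter_walkZ iter_walkD iter_walkD iter_walkZ iter_walk_cst// iter_walk_sqn// nh2.
  have := iter_walk_sqn2 h n d0; rewrite nh2.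
  set q2 := iter n _ _ _ => q2le.
  rewrite mulrC ler_pdivlMr//.
  have : (12 * t)^-1 * q2 <= t / 4.
    rewrite ler_pdivrMl ?mulr_gt0// (le_trans q2le)//.
    by rewrite le_eqVlt; apply/orP; left; apply/eqP; field.
  lra.
move: Gl; rewrite iter_walkD iter_walk_cst// iter_walkZ => Gl.
have := le_trans Gl Gup.
have : B * 2^-1 <= B * iter n (walk h) p 0 by rewrite ler_wpM2l// ltW.
have := st0; have AE : A = 6 * (s * t * (C1 + 1)) + 6 * (s * t) by rewrite /A; ring.
rewrite /B; move: AE; move: (s * t * (C1 + 1)) => X AE; lra.
Qed.

End low_potential_nearby.

(** * Minimisers *)

Section minimisers.
Context {R : realType} {d : nat}.
Implicit Types (W : 'rV[R]_d -> \bar R).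

Definition interaction W N (X : 'I_N -> 'rV[R]_d) (i : 'I_N) : R :=
  \sum_(j < N | j != i) fine (W (X i - X j)).

Lemma potential_fin W N (X : 'I_N -> 'rV[R]_d) i :
  (forall i j, i != j -> W (X i - X j) \is a fin_num) ->
  potential W X i = (N%:R^-1 * interaction W X i)%:E.
Proof.
move=> Xfin; rewrite /potential (eq_bigr (fun j => (fine (W (X i - X j)%R))%:E)).
  by rewrite sumEFin -EFinM.
by move=> j ji; rewrite fineK// Xfin// eq_sym.
Qed.

Lemma energy_fin W N (X : 'I_N -> 'rV[R]_d) :
  (forall i j, i != j -> W (X i - X j) \is a fin_num) ->
  energy W X = ((2 * N%:R ^+ 2)^-1 * \sum_i interaction W X i)%:E.
Proof.
move=> Xfin; rewrite /energy (eq_bigr (fun i => (interaction W X i)%:E)).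
  by rewrite sumEFin -EFinM.
move=> i _; rewrite (eq_bigr (fun j => (fine (W (X i - X j)%R))%:E)) ?sumEFin//.
by move=> j ji; rewrite fineK// Xfin// eq_sym.
Qed.

Lemma potential_spread W N (X : 'I_N -> 'rV[R]_d) (e : R) : (0 < N)%N ->
  (forall i j, i != j -> W (X i - X j) \is a fin_num) ->
  (forall i k, interaction W X i <= interaction W X k + N%:R * e) ->
  forall i, (`|potential W X i - 2%:E * energy W X| <= e%:E)%E.
Proof.
move=> N0 Xfin Xe i; have NR : 0 < N%:R :> R by rewrite ltr0n.
rewrite potential_fin// energy_fin// -EFinM -EFinB abse_EFin lee_fin.
set S := interaction W X.
have -> : N%:R^-1 * S i - 2 * ((2 * N%:R ^+ 2)^-1 * \sum_k S k) =
    (N%:R ^+ 2)^-1 * \sum_k (S i - S k).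
  rewrite sumrB sumr_const card_ord -[S i *+ N]mulr_natl.
  by field; rewrite gt_eqF.
rewrite normrM ger0_norm ?invr_ge0 ?sqr_ge0// ler_pdivrMl ?exprn_gt0//.
apply: (le_trans (ler_norm_sum _ _ _)).
apply: (@le_trans _ _ (\sum_(k < N) N%:R * e)); last first.
  by rewrite sumr_const card_ord -[_ *+ N]mulr_natl mulrA expr2.
apply: ler_sum => k _; rewrite ler_norml.
have h1 := Xe i k; have h2 := Xe k i; rewrite -/S in h1 h2; lra.
Qed.

(** By symmetry the energy counts every pair through [i] twice; the pairs avoiding [i] are unchanged
    by the move and, being finite, cancel. *)
Lemma minimiser_move W N (X : 'I_N -> 'rV[R]_d) i y :
  (forall x, W (- x) = W x) -> minimiser W X ->
  (forall i j, i != j -> W (X i - X j) \is a fin_num) ->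
  (forall j, j != i -> W (y - X j) \is a fin_num) ->
  interaction W X i <= \sum_(j < N | j != i) fine (W (y - X j)).
Proof.
move=> Wsym Xmin Xfin yfin.
have NR : 0 < N%:R :> R by rewrite ltr0n (leq_ltn_trans _ (ltn_ord i)).
pose Y j := if j == i then y else X j.
have Yfin a b : a != b -> W (Y a - Y b) \is a fin_num.
  rewrite /Y => ab; case: (eqVneq a i) => [ai|ai]; case: (eqVneq b i) => [bi|bi].
  - by move: ab; rewrite ai bi eqxx.
  - exact: yfin.
  - by rewrite -Wsym opprB; exact: yfin.
  - exact: Xfin.
have tot Z : \sum_a interaction W Z a = 2 * interaction W Z i +
    \sum_(a | a != i) \sum_(b | (b != a) && (b != i)) fine (W (Z a - Z b)).
  rewrite (bigD1 i)//= mulr_natl mulr2n -addrA; congr (_ + _).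
  rewrite {2}/interaction -big_split/=; apply: eq_bigr => a ai.
  by rewrite /interaction (bigD1 i) 1?eq_sym//= -Wsym opprB.
have := Xmin Y; rewrite !energy_fin// lee_fin ler_pM2l; last first.
  by rewrite invr_gt0 mulr_gt0// exprn_gt0.
rewrite !tot (eq_bigr (fun a => \sum_(b | (b != a) && (b != i)) fine (W (X a - X b)))
   (F1 := fun a => \sum_(b | (b != a) && (b != i)) fine (W (Y a - Y b)))); last first.
  move=> a ai; apply: eq_bigr => b /andP[_ bi].
  by rewrite /Y (negbTE ai) (negbTE bi).
rewrite lerD2r ler_pM2l// => /le_trans; apply.
rewrite /interaction le_eqVlt; apply/orP; left; apply/eqP; apply: eq_bigr => j ji.
by rewrite /Y eqxx (negbTE ji).
Qed.

(** Distinct points on the diagonal have finite energy, whereas one infinite pair makes the energy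
    [+oo], the other terms being bounded below. *)
Lemma minimiser_finite W (b : R) N (X : 'I_N -> 'rV[R]_d) : (0 < d)%N ->
  (forall x, b%:E <= W x)%E -> (forall x, x != 0 -> W x \is a fin_num) ->
  minimiser W X -> forall i j, i != j -> W (X i - X j) \is a fin_num.
Proof.
move=> d0 Wb Wfin Xmin i j ij.
have NR : 0 < N%:R :> R by rewrite ltr0n (leq_ltn_trans _ (ltn_ord i)).
have c0 : 0 < (2 * N%:R ^+ 2)^-1 :> R by rewrite invr_gt0 mulr_gt0// exprn_gt0.
have Wny x : W x != -oo%E by rewrite gt_eqF// (lt_le_trans (ltNyr b)).
pose Y (a : 'I_N) : 'rV[R]_d := const_mx (nat_of_ord a)%:R.
have Yfin a c : a != c -> W (Y a - Y c) \is a fin_num.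
  move=> ac; apply: Wfin; apply: contra ac => /eqP/rowP/(_ (Ordinal d0)).
  rewrite !mxE => /eqP; rewrite subr_eq0 eqr_nat => /eqP h; apply/eqP/val_inj.
  exact: h.
rewrite fin_numE Wny/=; apply/eqP => Woo.
have := Xmin Y; rewrite (energy_fin Yfin) /energy.
rewrite (_ : (\sum_(a < N) \sum_(c < N | c != a) W (X a - X c)%R)%E = +oo%E).
  by rewrite gt0_muley ?lte_fin// leye_eq.
apply/eqP; rewrite esum_eqy; last first.
  move=> a _; rewrite gt_eqF//.
  rewrite (lt_le_trans _ (lee_sum _ (fun c _ => Wb (X a - X c))))// sumEFin.
  exact: ltNyr.
apply/existsP; exists i => /=; rewrite esum_eqy => [|c _]; last exact: Wny.
by apply/existsP; exists j; rewrite unfold_in eq_sym ij Woo eqxx.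
Qed.

End minimisers.

(** * The spread of the potentials in the repulsive case *)

Section repulsive_minimisers.
Context {R : realType} {d : nat}.

Lemma repulsive_minimiser_bound (W : 'rV[R]_d -> \bar R) (b beta CW : R) : (0 < d)%N ->
  2 < beta -> 0 < CW ->
  lower_semicontinuous W -> (forall x, b%:E <= W x)%E -> (forall x, W (- x) = W x) ->
  repulsive beta W -> C1_off_origin W -> (forall x, laplacian0 W x <= CW%:E)%E ->
  (forall x, enorm x <= 1 -> (W x <= CW%:E * enorm_npow x (2 - beta))%E) ->
  exists A : R, forall N (X : 'I_N -> 'rV[R]_d), minimiser W X ->
    forall i k, interaction W X i <= interaction W X k
      + N%:R * (A * N%:R `^ (- (2 / beta))).
Proof.
move=> d0 beta2 CW0 Wl Wb Wsym Wrep WC1 WC Wgrow.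
have W0 := repulsive_origin d0 beta2 Wl Wb Wrep.
have [Wloc _] := Wrep.
have [Wfin _] := WC1.
have beta0 : 0 < beta by lra.
pose C2 := 6 * (8 * d%:R ^+ 3 * CW) + 13.
have C20 : 0 <= C2 by rewrite addr_ge0// !mulr_ge0// ?exprn_ge0// ltW.
(* The 48 is 4 * 12: the inner radius of the annulus is given by t / 4, with t = tau / 12. *)
pose C3 := CW * 48^-1 `^ ((2 - beta) / 2).
have C30 : 0 <= C3 by rewrite mulr_ge0 ?powR_ge0// ltW.
exists (C2 + C3 + `|b|) => N X Xmin i k.
have N1 : 1 <= N%:R :> R by rewrite ler1n (leq_ltn_trans _ (ltn_ord i)).
have N0 : 0 < N%:R :> R by exact: lt_le_trans N1.
set tau := N%:R `^ (- (2 / beta)).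
have tau0 : 0 < tau by rewrite powR_gt0.
have tauN : N%:R^-1 <= tau.
  rewrite /tau -[leLHS]powR_inv1 ?ler0n// ler_powR// lerN2 ler_pdivrMr// mul1r ltW//.
have A0 : 0 <= N%:R * ((C2 + C3 + `|b|) * tau).
  by rewrite mulr_ge0 ?ler0n// mulr_ge0 ?(ltW tau0)// addr_ge0// addr_ge0.
have [<-|ik] := eqVneq i k; first by rewrite lerDl.
have tau1 : tau <= 1 by rewrite /tau -[leRHS](powRr0 N%:R) ler_powR// oppr_le0 divr_ge0// ltW.
have Xfin := minimiser_finite d0 Wb Wfin Xmin.
pose cs := [seq X k - X j | j <- index_enum 'I_N & j != k].
have sumcs (F : 'rV[R]_d -> R) :
    \sum_(c <- cs) F c = \sum_(j < N | j != k) F (X k - X j).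
  by rewrite big_map big_filter.
have csP (Q : 'rV[R]_d -> Prop) : (forall c, c \in cs -> Q c) ->
    forall j, j != k -> Q (X k - X j).
  move=> h j jk; apply: h; apply/mapP; exists j => //.
  by rewrite mem_filter jk mem_index_enum.
have szcs : (0 < size cs <= N)%N.
  rewrite size_map; apply/andP; split.
    by rewrite size_filter -has_count; apply/hasP; exists i; rewrite ?mem_index_enum.
  rewrite size_filter (leq_trans (count_size _ _))//.
  by rewrite -[leqRHS]card_ord cardE /enum_mem size_filter count_predT.
(* The choice tau / 12 gives tau / 48 < |z|^2 < tau <= 1, so the growth bound, stated on the unit
   ball, applies to [z]. *)
have [] := @low_potential_nearby R d W b CW (tau / 12) cs d0 (ltW CW0) Wl Wloc Wb WC WC1 W0.
- by rewrite divr_gt0.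
- by case/andP: szcs.
- by move=> c /mapP[j]; rewrite mem_filter eq_sym => /andP[kj _] ->; exact: Xfin.
- move=> z zfin; rewrite !sumcs.
  rewrite [leRHS](eq_bigr (fun j => fine (W (X k + z - X j)))) => [|j _]; last by rewrite addrAC.
  apply: minimiser_move => // j jk; rewrite addrAC.
  exact: (csP (fun c => W (c + z) \is a fin_num) zfin).
move=> z [z1 z2 zfin]; rewrite !sumcs -/C2 => zP.
have {}zfin j : j != k -> W (X k + z - X j) \is a fin_num.
  move=> jk; rewrite addrAC.
  exact: (csP (fun c => W (c + z) \is a fin_num) zfin).
have z0 : z != 0.
  apply/eqP => z0; move: z1; rewrite z0 /sqn big1 => [|j _]; last by rewrite mxE expr0n.
  by rewrite ltNge divr_ge0// divr_ge0// ltW.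
have kz : X k + z - X k = z by rewrite addrAC subrr add0r.
have yfin j : j != i -> W (X k + z - X j) \is a fin_num.
  by have [->|jk _] := eqVneq j k; [rewrite kz => _; exact: Wfin|exact: zfin].
have mv := minimiser_move Wsym Xmin Xfin yfin.
have ez0 : 0 < enorm z.
  rewrite lt_neqAle enorm_ge0 andbT eq_sym -sqrf_eq0 -sqn_enorm gt_eqF//.
  by apply: lt_trans z1; rewrite divr_gt0// divr_gt0.
have ez1 : enorm z <= 1.
  rewrite -(@ler_pXn2r _ 2)// ?nnegrE ?enorm_ge0// expr1n -sqn_enorm.
  apply: (le_trans (ltW z2)); lra.
have wz : fine (W z) <= C3 * N%:R * tau.
  have := Wgrow z ez1; rewrite /enorm_npow (negbTE z0) -EFinM.
  rewrite -{1}(fineK (Wfin z z0)) lee_fin => /le_trans; apply.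
  rewrite /C3 -!mulrA ler_wpM2l ?(ltW CW0)//.
  (* This identity determines tau: the self-interaction, of order tau^((2-beta)/2), then equals N
     times an error of order tau. *)
  have -> : N%:R * tau = tau `^ ((2 - beta) / 2).
    rewrite /tau -powRrM -{1}(@powRr1 _ N%:R) ?ler0n// -powRD; last first.
      by apply/implyP => _; rewrite gt_eqF.
    by congr (_ `^ _); field; rewrite gt_eqF.
  rewrite -powRM ?invr_ge0//; last exact: ltW.
  have -> : enorm z `^ (2 - beta) = sqn z `^ ((2 - beta) / 2).
    rewrite sqn_enorm -powR_mulrn ?enorm_ge0// -powRrM; congr (_ `^ _); by field.
  have b2 : (2 - beta) / 2 = - ((beta - 2) / 2) by field.
  have sq0 : 0 < sqn z by rewrite sqn_enorm exprn_gt0.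
  have q0 : 0 < 48^-1 * tau by rewrite mulr_gt0.
  rewrite b2 !powRN lef_pV2 ?posrE ?powR_gt0//.
  apply: ge0_ler_powR; rewrite ?nnegrE ?sqn_ge0//.
  - by rewrite divr_ge0// subr_ge0 ltW.
  - by rewrite mulr_ge0 ?invr_ge0// ltW.
  - apply: le_trans (ltW z1); rewrite le_eqVlt; apply/orP; left; apply/eqP; by field.
apply: (le_trans mv); rewrite (bigD1 k) 1?eq_sym//= kz.
(* The potential at X k + z includes the particle [i], which is the one being moved; removing its
   term costs at most |b|, and |b| <= N tau |b|. *)
have wi : b <= fine (W (X k + z - X i)).
  by rewrite -lee_fin fineK// zfin.
have e2 : \sum_(j < N | (j != i) && (j != k)) fine (W (X k + z - X j)) =
    \sum_(j < N | j != k) fine (W (X k - X j + z)) - fine (W (X k + z - X i)).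
  rewrite [in RHS](bigD1 i)//= addrAC [in RHS](addrAC (X k)) subrr add0r.
  by apply: eq_big => [j|j _]; [rewrite andbC|rewrite addrAC].
rewrite e2.
have sz : (size cs)%:R * (tau / 12) * C2 <= N%:R * C2 * tau.
  rewrite mulrAC.
  apply: ler_pM; rewrite ?mulr_ge0 ?divr_ge0 ?(ltW tau0)//.
    by rewrite ler_wpM2r// ler_nat; case/andP: szcs.
  by rewrite ler_pdivrMr// ler_peMr ?(ltW tau0)// ler1n.
have Nt : `|b| <= N%:R * tau * `|b|.
  by rewrite ler_peMl// -[leLHS](mulfV (lt0r_neq0 N0)) ler_wpM2l ?ler0n.
have nb : - b <= `|b| by rewrite -normrN ler_norm.
rewrite /interaction.
rewrite (_ : N%:R * ((C2 + C3 + `|b|) * tau) = N%:R * C2 * tau + C3 * N%:R * tau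
  + N%:R * tau * `|b|); last by ring.
lra.
Qed.

End repulsive_minimisers.

Local Open Scope ereal_scope.

Theorem theorem4p9 (R : realType) (d : nat) (W : 'rV[R]_d -> \bar R)
    (Wmin : R) (Winf : \bar R) (RW : R)
    (d_ge1 : (1 <= d)%N)
    (W_lsc : lower_semicontinuous W)
    (W_ge : forall x, Wmin%:E <= W x)
    (W_locint : locally_integrable_rV W)
    (W_sym : forall x, W (- x)%R = W x)
    (Winf_neq : Winf != -oo)
    (W_lim : W @ at_infinity --> Winf)
    (RW_gt0 : (0 < RW)%R)
    (W_incr : radially_increasing_outside RW W) :
  ((exists M : R, forall x, W x <= M%:E) -> upper_semicontinuous W ->
    forall (N : nat) (X : 'I_N -> 'rV[R]_d), (2 <= N)%N -> minimiser W X ->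
    forall i : 'I_N,
      `|potential W X i - 2%:E * energy W X|
        <= (N%:R^-1)%:E * (W 0%R - Wmin%:E))
  /\
  (forall beta CW : R, (2 < beta)%R -> (beta < d%:R)%R ->
    repulsive beta W -> C1_off_origin W -> (0 < CW)%R ->
    (forall x, laplacian0 W x <= CW%:E) ->
    (forall x, (enorm x <= 1)%R -> W x <= CW%:E * enorm_npow x (2 - beta)) ->
    (forall x, (0 < enorm x <= 1)%R ->
      (enorm (gradient (fine \o W) x) <= CW * enorm x `^ (1 - beta))%R) ->
    exists A k : R, [/\ (1 < A)%R, (0 < k <= 1)%R,
      k = (2 / ((beta - 1) * beta))%R &
      forall (N : nat) (X : 'I_N -> 'rV[R]_d), (2 <= N)%N -> minimiser W X ->
      forall i : 'I_N,
        `|potential W X i - 2%:E * energy W X| <= (A * N%:R `^ (- k))%:E]).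
Proof.
have d0 : (0 < d)%N by [].
split=> [[M WM] _ N X N2 Xmin i|beta CW beta2 betad Wrep WC1 CW0 WC Wgrow _].
  have Wfin x : W x \is a fin_num.
    rewrite fin_real// (lt_le_trans (ltNyr Wmin) (W_ge x))/=.
    by rewrite (le_lt_trans (WM x))// ltry.
  have N0 : (0 < N)%N by exact: leq_trans N2.
  have NR : (0 < N%:R :> R)%R by rewrite ltr0n.
  have W_fge x : (Wmin <= fine (W x))%R by rewrite -lee_fin fineK.
  rewrite -(fineK (Wfin 0%R)) -EFinB -EFinM.
  apply: potential_spread => // {}i k; rewrite mulrA mulfV ?gt_eqF// mul1r.
  have [<-|ik] := eqVneq i k; first by rewrite lerDl subr_ge0.
  apply: (le_trans (@minimiser_move _ _ W N X i (X k) W_sym Xmin (fun _ _ _ => Wfin _)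
    (fun _ _ => Wfin _))).
  rewrite (bigD1 k) 1?eq_sym//= subrr /interaction (bigD1 i (P := fun j => j != k))//=.
  rewrite (eq_bigl (fun j => (j != k) && (j != i))); last by move=> j; rewrite andbC.
  have := W_fge (X k - X i)%R; lra.
have [A0 A0P] := repulsive_minimiser_bound d0 beta2 CW0 W_lsc W_ge W_sym Wrep WC1 WC Wgrow.
have beta0 : (0 < beta)%R by lra.
have bb : (2 <= (beta - 1) * beta)%R by nra.
have bb0 : (0 < (beta - 1) * beta)%R by exact: lt_le_trans bb.
(* The summand 2 secures [1 < A]. *)
exists (`|A0| + 2)%R, (2 / ((beta - 1) * beta))%R; split => //.
- by have := normr_ge0 A0; lra.
- by rewrite divr_gt0//= ler_pdivrMr// mul1r.
move=> N X N2 Xmin i.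
have N0 : (0 < N)%N by exact: leq_trans N2.
have Xfin := minimiser_finite d0 W_ge (proj1 WC1) Xmin.
apply: (le_trans (potential_spread N0 Xfin (A0P N X Xmin) i)); rewrite lee_fin.
apply: (@le_trans _ _ ((`|A0| + 2) * N%:R `^ (- (2 / beta)))%R).
  by rewrite ler_wpM2r ?powR_ge0// (le_trans (ler_norm A0))// lerDl.
rewrite ler_wpM2l ?addr_ge0// ler_powR ?ler1n// lerN2.
rewrite ler_pM2l// lef_pV2 ?posrE// ler_peMl ?(ltW beta0)//; lra.
Qed.
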